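(* Regard $C([0,1])\subset L^\infty([0,1])$ (Lebesgue measure) by identifying a continuous function with its equivalence class. Then the set $\mathcal F_{L^\infty([0,1])}(C([0,1]))$ is equal to the set of equivalence classes of Riemann integrable functions. That is, for $[g]\in L^\infty([0,1])$, one has $[g]\in\mathcal F_{L^\infty([0,1])}(C([0,1]))$ if and only if $f=g$ a.e. for some Riemann integrable function $f$ on $[0,1]$.
   Context: For operator spaces $V\subseteq W$, $\mathcal F_W(V)=\{T\in W:\phi(T)=T$ for every completely contractive map $\phi:W\to W$ that is the identity on $V\}$. For $V=C([0,1])$ and $W=L^\infty([0,1])$ this is the set of elements of $L^\infty([0,1])$ fixed by every positive map $L^\infty([0,1])\to L^\infty([0,1])$ that fixes $C([0,1])$. *)

(* Defs.v *)
From HB Require Import structures.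
From mathcomp Require Import all_boot all_order all_algebra.
From mathcomp Require Import complex.
From mathcomp Require Import all_classical all_reals all_analysis.
From mathcomp Require Import measurable_realfun ess_sup_inf.

Set Implicit Arguments.
Unset Strict Implicit.
Unset Printing Implicit Defensive.

Import Order.TTheory GRing.Theory Num.Theory.
Import numFieldNormedType.Exports.

Local Open Scope classical_set_scope.
Local Open Scope ring_scope.
Local Open Scope quotient_scope.

Section cmod.
Variable R : realType.
Implicit Types z w : R[i].

(* The library norm `|z| of a complex number is valued in R[i]; this is the
   same modulus, valued in R. *)
Definition cmod z : R := complex.Re `|z|.

Lemma cmodE z : (cmod z)%:C%C = `|z|.
Proof. by rewrite /cmod normc_def. Qed.

Lemma cmod0 : cmod 0 = 0.
Proof. by rewrite /cmod normr0. Qed.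

Lemma cmodD z w : cmod (z + w) <= cmod z + cmod w.
Proof. by rewrite -lecR rmorphD /= !cmodE ler_normD. Qed.

Lemma cmodM z w : cmod (z * w) = cmod z * cmod w.
Proof. by apply: (@complexI R); rewrite rmorphM /= !cmodE normrM. Qed.

Lemma cmod_ge0 z : 0 <= cmod z.
Proof. by rewrite -lecR cmodE normr_ge0. Qed.

Definition l2norm n (v : 'cV[R[i]]_n) : R :=
  Num.sqrt (\sum_i cmod (v i 0) ^+ 2).

Definition opnorm n (A : 'M[R[i]]_n) : R :=
  sup [set l2norm (A *m v) | v in [set v | l2norm v <= 1]].

End cmod.

(* Complex L^oo of a measure space: essentially bounded measurable functions,
   modulo equality almost everywhere. *)
Section Linf.
Context d (T : measurableType d) (R : realType).
Variable mu : {measure set T -> \bar R}.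

Definition cmeasurable (f : T -> R[i]) :=
  measurable_fun setT (fun x => complex.Re (f x)) /\
  measurable_fun setT (fun x => complex.Im (f x)).

Definition ess_bounded (f : T -> R[i]) :=
  exists M : R, \forall x \ae mu, cmod (f x) <= M.

Definition Linf_pred : {pred T -> R[i]} :=
  fun f => `[< cmeasurable f /\ ess_bounded f >].

Let Linf_submod_closed : submod_closed Linf_pred.
Proof.
split=> [|a f g].
  apply/asboolP; split; first by split; exact: measurable_cst.
  by exists 0; apply: nearW => x; rewrite cmod0.
move=> /asboolP[[mfr mfi] [M Mf]] /asboolP[[mgr mgi] [N Ng]].
apply/asboolP; split; first split.
- rewrite (_ : (fun x => _) = (fun x => complex.Re a * complex.Re (f x)
      - complex.Im a * complex.Im (f x) + complex.Re (g x))).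
    apply: measurable_funD => //; apply: measurable_funB;
      by apply: measurable_funM => //; exact: measurable_cst.
  apply/funext => x /=; rewrite /GRing.add /GRing.scale /=.
  by case: (f x) (g x) a => [? ?] [? ?] [? ?].
- rewrite (_ : (fun x => _) = (fun x => complex.Re a * complex.Im (f x)
      + complex.Im a * complex.Re (f x) + complex.Im (g x))).
    apply: measurable_funD => //; apply: measurable_funD;
      by apply: measurable_funM => //; exact: measurable_cst.
  apply/funext => x /=; rewrite /GRing.add /GRing.scale /=.
  by case: (f x) (g x) a => [? ?] [? ?] [? ?].
exists (cmod a * M + N); apply: filterS2 Mf Ng => x fM gN.
rewrite (le_trans (cmodD _ _))// lerD// cmodM.
by rewrite ler_wpM2l// cmod_ge0.
Qed.

HB.instance Definition _ := GRing.isSubmodClosed.Build _ _ Linf_pred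
  Linf_submod_closed.

Record Linf_fun := MkLinf_fun {
  Linf_val :> T -> R[i];
  Linf_valP : Linf_val \in Linf_pred }.

HB.instance Definition _ := [isSub for Linf_val].
HB.instance Definition _ := [Choice of Linf_fun by <:].
HB.instance Definition _ := [SubChoice_isSubLmodule of Linf_fun by <:].

Definition ae_null : {pred Linf_fun} :=
  fun f => `[< \forall x \ae mu, f x = 0 >].

Let ae_null_zmod_closed : zmod_closed ae_null.
Proof.
split=> [|f g /asboolP f0 /asboolP g0]; apply/asboolP; first exact: nearW.
by apply: filterS2 f0 g0 => x /= fx gx; rewrite !fctE fx gx subr0.
Qed.

HB.instance Definition _ := GRing.isZmodClosed.Build _ ae_null
  ae_null_zmod_closed.

Definition Linf : Type := Quotient.quot ae_null.

HB.instance Definition _ := Choice.on Linf.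
HB.instance Definition _ := EqQuotient.on Linf.
HB.instance Definition _ := GRing.Zmodule.on Linf.

Definition Linf_scale (a : R[i]) (g : Linf) : Linf := \pi_Linf (a *: repr g).

Let scaleE a (f : Linf_fun) : Linf_scale a (\pi_Linf f) = \pi_Linf (a *: f).
Proof.
apply/eqmodP; rewrite /= /Quotient.equiv -scalerBr.
have /eqmodP/asboolP h : \pi_Linf (repr (\pi_Linf f)) = \pi_Linf f.
  by rewrite reprK.
by apply/asboolP; apply: filterS h => x /= hx; rewrite fctE hx scaler0.
Qed.

Let piD (f g : Linf_fun) : \pi_Linf (f + g) = \pi_Linf f + \pi_Linf g.
Proof. exact: (Quotient.pi_add ae_null f g). Qed.

Let scalerA_ a b (g : Linf) :
  Linf_scale a (Linf_scale b g) = Linf_scale (a * b) g.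
Proof. by rewrite -[g]reprK (scaleE b) !scaleE scalerA. Qed.

Let scale1r_ : left_id 1 Linf_scale.
Proof. by move=> g; rewrite -[g]reprK scaleE scale1r. Qed.

Let scalerDr_ : right_distributive Linf_scale +%R.
Proof.
by move=> a f g; rewrite -[f]reprK -[g]reprK -piD !scaleE scalerDr piD.
Qed.

Let scalerDl_ (g : Linf) : {morph Linf_scale^~ g : a b / a + b}.
Proof. by move=> a b; rewrite -[g]reprK !scaleE scalerDl piD. Qed.

HB.instance Definition _ := GRing.Zmodule_isLmodule.Build R[i] Linf
  scalerA_ scale1r_ scalerDr_ scalerDl_.

Definition is_class_of (g : Linf) (f : T -> R[i]) :=
  \forall x \ae mu, f x = repr g x.

Lemma is_class_of_pi (f : Linf_fun) : is_class_of (\pi_Linf f) f.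
Proof.
have /eqmodP/asboolP h : \pi_Linf f = \pi_Linf (repr (\pi_Linf f)).
  by rewrite reprK.
by apply: filterS h => x /= /eqP; rewrite subr_eq0 => /eqP.
Qed.

Lemma is_class_of_inj (g h : Linf) (f : T -> R[i]) :
  is_class_of g f -> is_class_of h f -> g = h.
Proof.
move=> gf hf; rewrite -[g]reprK -[h]reprK; apply/eqmodP/asboolP.
by apply: filterS2 gf hf => x /= fg fh; rewrite !fctE -fg -fh subrr.
Qed.

(* Canonical operator space structure of the commutative von Neumann algebra
   L^oo: M_n(L^oo) = L^oo(M_n), with M_n normed as operators on l^2_n. *)
Definition Linf_mxnorm n (F : 'M[Linf]_n) : \bar R :=
  ess_sup mu (fun x => (opnorm (\matrix_(i, j) repr (F i j) x))%:E).

End Linf.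

Arguments is_class_of {d T R} mu g f.
Arguments Linf_mxnorm {d T R} mu {n} F.

(* An operator space is given by W and its matrix norms; Ruan's axioms on them
   play no role in the definitions. *)
Section fixed_set.
Context (R : realType) (W : lmodType R[i]).
Variable mxnorm : forall n, 'M[W]_n -> \bar R.

Definition completely_contractive (phi : W -> W) :=
  forall n (F : 'M[W]_n), (mxnorm (map_mx phi F) <= mxnorm F)%E.

Definition fixed_set (V : set W) : set W :=
  [set x | forall phi : {linear W -> W}, completely_contractive phi ->
    (forall v, V v -> phi v = v) -> phi x = x].

End fixed_set.

Section unit_interval.
Variable R : realType.

Let measurable01 : measurable (`[0, 1]%classic : set (measurableTypeR R)).
Proof. exact: measurable_itv. Qed.

(* Lebesgue measure on [0, 1], as a measure on R giving mass 0 to the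
   complement of [0, 1]; values outside [0, 1] are thus irrelevant in
   Linf lebesgue01. Measurability is Borel measurability, which gives the same
   classes as Lebesgue measurability. *)
Definition lebesgue01 : {measure set (measurableTypeR R) -> \bar R} :=
  mrestr (@lebesgue_measure R) measurable01.

Definition C01 : set (Linf lebesgue01) :=
  [set g | exists2 f : R -> (R[i])^o,
    {within `[0, 1], continuous f} & is_class_of lebesgue01 g f].

End unit_interval.

Section riemann.
Context (R : realType) (a b : R).

(* 0-th point of the partition a :: s is a, (i.+1)-th point is s`_i; the tag
   of the i-th interval is t`_i. *)
Definition tagged_partition (s t : seq R) :=
  [/\ itv_partition a b s, size t = size s &
   forall i, (i < size s)%N -> (a :: s)`_i <= t`_i <= s`_i].

Definition mesh_lt (s : seq R) (delta : R) :=
  forall i, (i < size s)%N -> s`_i - (a :: s)`_i < delta.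

Definition riemann_sum (f : R -> R[i]) (s t : seq R) : R[i] :=
  \sum_(i < size s) f t`_i * (s`_i - (a :: s)`_i)%:C%C.

Definition riemann_integrable (f : R -> R[i]) :=
  exists I : R[i], forall eps : R, 0 < eps ->
    exists2 delta : R, 0 < delta &
      forall s t, tagged_partition s t -> mesh_lt s delta ->
        cmod (riemann_sum f s t - I) < eps.

End riemann.

(* Main.v *)
Require Import Defs.
From HB Require Import structures.
From mathcomp Require Import all_boot all_order all_algebra.
From mathcomp Require Import complex.
From mathcomp Require Import all_classical all_reals all_analysis.
From mathcomp Require Import measurable_realfun ess_sup_inf.
From mathcomp Require Import ring lra.

Set Implicit Arguments.
Unset Strict Implicit.
Unset Printing Implicit Defensive.

Import Order.TTheory GRing.Theory Num.Theory.
Import numFieldNormedType.Exports.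

Local Open Scope classical_set_scope.
Local Open Scope ring_scope.

(** Write mu for Lebesgue measure on [0, 1].

    Riemann integrable classes are fixed.  Let phi be a contraction of L^oo(mu)
    that is the identity on continuous functions.  Since phi 1 = 1, phi
    preserves inclusion of the values in a disc; the points z with 0 <= Re z and
    |z| <= M lie in the discs |z - n|^2 <= M^2 + n^2, whose points have real part
    at least - M^2 / (2 n), so phi preserves nonnegativity of the real part
    ([phi_Re_ge0]), hence lower bounds by continuous functions ([phi_Re_ge]).
    Comparing with piecewise linear continuous functions that equal c inside
    ]p, q[ and drop to a global lower bound near its ends, a lower bound c of
    Re g on ]p, q[ is also one of Re (phi g) there ([phi_local_lb]).  So on
    every interval of a partition Re g and Re (phi g) lie between the same two
    constants, which are, up to eps, values at tags of any function f in the
    class of g.  If f is Riemann integrable, the integral of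
    |Re (phi g) - Re g| is thus bounded by a difference of two Riemann sums of f
    plus a multiple of eps, and vanishes ([riemann_fixed_Re]).  Multiplying by
    - i yields the imaginary part.

    Fixed classes are Riemann integrable.  Let k be the real part of g.  For
    each n cut the line into cells of length 1 / (n + 1), choose in each cell a
    set of positive measure on which k is within 1 / (n + 1) of its essential
    supremum over the cell, and let L_n h be, on that cell, the average of h
    over the chosen set.  The L_n are positive and unital and tend to the
    identity on continuous functions, while L_n k is close to the essential
    suprema of k over the cells.  A limit point Phi of the L_n is needed that is
    defined on all of L^oo(mu), and it is obtained weakly: along an ultrafilter
    the integrals of L_n h over B converge, for every B, to a finitely additive
    function of B that is dominated by a multiple of mu, so that the
    Radon-Nikodym theorem gives it a density Phi h ([limit_operator]).  The map
    Phi fixes continuous functions, but if Phi k = k then at almost every x the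
    function k is essentially at most k x + eps near x
    ([extremal_limit_operator]).  The complex-linear extension of a positive
    unital map is completely contractive, because the norm of a matrix is
    determined by countably many inequalities Re <w, A v> <= constant
    ([complexification]).  Using this for g, - g, i g and - i g, an element g
    fixed by all completely contractive maps is essentially continuous at
    almost every point ([fixed_ess_continuous]).  The infimum of the local
    essential upper bounds of Re g then agrees with Re g almost everywhere and
    is an honest bounded function, continuous almost everywhere
    ([ess_continuous_riemann]); its Riemann sums converge by dominated
    convergence ([ae_continuous_riemann]). *)

(** * Integrals and almost everywhere inequalities *)

Section Rintegral_ae.
Context d (T : measurableType d) (R : realType).
Variable mu : {measure set T -> \bar R}.
Implicit Types (f g : T -> R) (D B : set T).

Lemma ae_eq_Rintegral D f g : measurable D -> measurable_fun D f ->
  measurable_fun D g -> (\forall x \ae mu, D x -> f x = g x) ->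
  \int[mu]_(x in D) f x = \int[mu]_(x in D) g x.
Proof.
move=> mD mf mg fg; rewrite /Rintegral; congr fine.
apply: ae_eq_integral => //; [exact/measurable_EFinP|exact/measurable_EFinP|].
by apply: filterS fg => x fg Dx /=; rewrite fg.
Qed.

Lemma ae_le_Rintegral D f g : measurable D ->
  mu.-integrable D (EFin \o f) -> mu.-integrable D (EFin \o g) ->
  (\forall x \ae mu, D x -> f x <= g x) ->
  \int[mu]_(x in D) f x <= \int[mu]_(x in D) g x.
Proof.
move=> mD intf intg fg.
have mf : measurable_fun D f by apply/measurable_EFinP/(measurable_int mu).
have mg : measurable_fun D g by apply/measurable_EFinP/(measurable_int mu).
have mgf : measurable_fun D (fun x => g x - f x) by exact: measurable_funB.
rewrite -subr_ge0 -RintegralB//.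
rewrite (@ae_eq_Rintegral _ _ (fun x => `|g x - f x|))//.
- by apply: Rintegral_ge0 => x _.
- exact: measurableT_comp.
- by apply: filterS fg => x fg Dx; rewrite ger0_norm// subr_ge0 fg.
Qed.

Lemma EFin_Rintegral D f : measurable D -> mu.-integrable D (EFin \o f) ->
  (\int[mu]_(x in D) f x)%:E = (\int[mu]_(x in D) (f x)%:E)%E.
Proof. by move=> mD intf; rewrite /Rintegral fineK//; exact: integrable_fin_num. Qed.

Lemma Rintegral_ae_le D f g : measurable D ->
  mu.-integrable D (EFin \o f) -> mu.-integrable D (EFin \o g) ->
  (forall B, measurable B -> B `<=` D ->
    \int[mu]_(x in B) f x <= \int[mu]_(x in B) g x) ->
  \forall x \ae mu, D x -> f x <= g x.
Proof.
move=> mD intf intg fg; pose N := D `&` [set x | g x < f x].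
have mf : measurable_fun D f by apply/measurable_EFinP/(measurable_int mu).
have mg : measurable_fun D g by apply/measurable_EFinP/(measurable_int mu).
have mN : measurable N by exact: measurable_fun_ltr.
have ND : N `<=` D by exact: subIsetl.
have iS h E : mu.-integrable D (EFin \o h) -> measurable E -> E `<=` D ->
  mu.-integrable E (EFin \o h) by move=> ih mE ED; exact: integrableS ih.
have : ae_eq mu N (EFin \o f) (EFin \o g).
  apply: integral_ae_eq => //; first exact: iS.
    by apply: (@measurable_int _ _ _ mu); exact: iS.
  move=> E EN mE; have ED : E `<=` D by exact: subset_trans ND.
  have ifE := iS _ _ intf mE ED; have igE := iS _ _ intg mE ED.
  rewrite /= -!EFin_Rintegral//; congr EFin; apply/eqP; rewrite eq_le fg//=.
  by apply: le_Rintegral => // x /EN[_ /ltW].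
apply: filterS => x Nx Dx; rewrite leNgt; apply/negP => gf.
have [fgx] := Nx (conj Dx gf).
by move: gf; rewrite fgx ltxx.
Qed.

End Rintegral_ae.

Section ae_countable.
Context d (T : measurableType d) (R : realType).
Variable mu : {measure set T -> \bar R}.

Lemma ae_forall_countable (I : countType) (P : I -> T -> Prop) :
  (forall i, \forall x \ae mu, P i x) -> \forall x \ae mu, forall i, P i x.
Proof.
move=> h; have /ae_foralln : forall k, \forall x \ae mu,
    if unpickle k is Some i then P i x else True.
  by move=> k; case: unpickle => [i|]; [exact: h|exact: aeW].
by apply: filterS => x hx i; have := hx (pickle i); rewrite pickleK.
Qed.

End ae_countable.

(** * Set functions dominated by a finite measure *)

Section dominated_density.
Context d (T : measurableType d) (R : realType).
Variable mu : {measure set T -> \bar R}.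
Hypothesis mu_fin : (mu setT < +oo)%E.
Variables (nu : set T -> R) (M : R).
Hypothesis nuU : forall A B, measurable A -> measurable B -> A `&` B = set0 ->
  nu (A `|` B) = nu A + nu B.
Hypothesis nu_mu : forall A, measurable A -> `|nu A| <= M * fine (mu A).

Let nu0 : nu set0 = 0.
Proof.
by have := nu_mu measurable0; rewrite measure0 mulr0 normr_le0 => /eqP.
Qed.

Let sigma_additive : semi_sigma_additive (EFin \o nu).
Proof.
move=> F mF tF mUF.
pose S n := \big[setU/set0]_(i < n) F i.
pose tl n := \bigcup_n F n `\` S n.
have mS n : measurable (S n) by exact: bigsetU_measurable.
have mtl n : measurable (tl n) by exact: measurableD.
have nuS n : \sum_(0 <= i < n) nu (F i) = nu (S n).
  elim: n => [|n IH]; first by rewrite big_geq// /S big_ord0 nu0.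
  rewrite big_nat_recr//= IH /S big_ord_recr/= nuU//.
    exact: mS.
  apply: (@trivIset_bigsetUI _ xpredT) => //.
  by move/trivIsetP : tF => tF; apply/trivIsetP => i j _ _; exact: tF.
have nutl n : nu (\bigcup_n F n) = nu (S n) + nu (tl n).
  rewrite -nuU//; last by rewrite /tl setDE setICA setICr setI0.
  congr nu; rewrite setDUK// /S.
  by apply: bigsetU_bigcup.
have tl0 : fine (mu (tl n)) @[n --> \oo] --> 0.
  have capT : \bigcap_n tl n = set0.
    rewrite -subset0 => x xtl; have [[m _ Fmx] _] := xtl 0%N I.
    by have [_] := xtl m.+1 I; apply; rewrite /S big_ord_recr/=; right.
  have : mu \o tl @ \oo --> mu (\bigcap_n tl n).
    apply: nonincreasing_cvg_mu => //.
    - by rewrite (le_lt_trans _ mu_fin)// le_measure ?inE.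
    - by rewrite capT.
    - move=> m n mn; apply/subsetPset; apply: setDS;
      exact: (@subset_bigsetU _ F m n mn).
  by rewrite capT measure0 => /fine_cvg.
rewrite [X in X @ _ --> _](_ : _ = EFin \o (nu \o S)); last first.
  by apply/funext => n; rewrite /= -nuS sumEFin.
apply: cvg_EFin; first exact: nearW.
rewrite [X in X @ _ --> _](_ : _ = fun n => nu (\bigcup_n F n) - nu (tl n)); last first.
  by apply/funext => n /=; rewrite (nutl n) addrK.
rewrite -[X in _ --> X]subr0; apply: cvgB; first exact: cvg_cst.
apply/norm_cvg0P.
apply: (@squeeze_cvgr _ _ _ _ (cst 0) (fun n => M * fine (mu (tl n)))).
- by apply: nearW => n; rewrite normr_ge0/= nu_mu.
- exact: cvg_cst.
- by rewrite -[X in _ --> X](mulr0 M); apply: cvgM => //; exact: cvg_cst.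
Qed.

HB.instance Definition _ := isCharge.Build _ _ _ (EFin \o nu)
  (congr1 EFin nu0) (fun _ _ => erefl) sigma_additive.

(* An alias of mu that can carry the structure of a finite measure. *)
Let m : set T -> \bar R := mu.
HB.instance Definition _ := Measure.on m.
HB.instance Definition _ :=
  @Measure_isFinite.Build _ _ _ m (lty_fin_num_fun mu_fin).
Let fmu : {finite_measure set T -> \bar R} := m.

(** The bound by M mu turns finite additivity into countable additivity, since
    the measure of the tail of a disjoint union tends to 0; Radon-Nikodym then
    applies. *)
Lemma dominated_density : exists2 psi : T -> R,
  mu.-integrable setT (EFin \o psi) &
  forall A, measurable A -> \int[mu]_(x in A) psi x = nu A.
Proof.
pose ch : {charge set T -> \bar R} := EFin \o nu.
have nu_dom : ch `<< fmu.
  apply/null_content_dominatesP => A mA muA0; rewrite /ch/=; congr EFin.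
  by have := nu_mu mA; rewrite muA0 mulr0 normr_le0 => /eqP.
have intD := Radon_Nikodym_integrable nu_dom.
have finD x : (Radon_Nikodym ch fmu) x \is a fin_num.
  exact: Radon_Nikodym_fin_num.
have DE : EFin \o (fine \o (Radon_Nikodym ch fmu)) = (Radon_Nikodym ch fmu).
  by apply/funext => x; rewrite /= fineK.
exists (fine \o (Radon_Nikodym ch fmu)); first by rewrite DE.
move=> A mA; rewrite /Rintegral -[nu A]/(fine (ch A)).
by rewrite (Radon_Nikodym_integral nu_dom mA); congr fine; rewrite -DE.
Qed.

End dominated_density.

(** * Weak limits of operators on real L^oo *)

Section ess_bounded_real.
Context d (T : measurableType d) (R : realType).
Variable mu : {measure set T -> \bar R}.
Implicit Types (f g h : T -> R).

Definition ae_bounded h (M : R) := \forall x \ae mu, `|h x| <= M.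

(** Representatives of elements of the real space L^oo.  Working with
    functions instead of classes avoids a second quotient: the operators below
    respect equality almost everywhere as a consequence of linearity and
    positivity. *)
Definition real_Linf h := measurable_fun setT h /\ exists M, ae_bounded h M.

Lemma real_Linf_cst c : real_Linf (cst c).
Proof. by split=> //; exists `|c|; exact: aeW. Qed.

Lemma real_Linf_lin a h g : real_Linf h -> real_Linf g ->
  real_Linf (fun x => a * h x + g x).
Proof.
move=> [mh [M hM]] [mg [N gN]]; split.
  by apply: measurable_funD => //; apply: measurable_funM => //; exact: measurable_cst.
exists (`|a| * M + N); apply: filterS2 hM gN => x hM gN.
by rewrite (le_trans (ler_normD _ _))// lerD// normrM ler_wpM2l.
Qed.

Lemma real_Linf_integrable h B : (mu setT < +oo)%E -> real_Linf h -> measurable B ->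
  mu.-integrable B (EFin \o h).
Proof.
move=> mu_fin [mh [M hM]] mB.
apply: (@integrableS _ _ _ _ setT) => //; apply/integrableP; split.
  exact/measurable_EFinP.
apply: (@le_lt_trans _ _ (\int[mu]_x (`|M|)%:E)%E).
  apply: ae_ge0_le_integral => //.
  - by apply: measurableT_comp => //; exact/measurable_EFinP.
  - by apply: filterS hM => x hM _; rewrite lee_fin (le_trans hM)// ler_norm.
by rewrite integral_cst// lte_mul_pinfty.
Qed.

End ess_bounded_real.

Section ultrafilter_limit.
Context (R : realType) (U : set_system nat).
Hypothesis UU : UltraFilter U.

Lemma ultra_bounded_cvg (u : nat -> R) (C : R) : (forall n, `|u n| <= C) ->
  cvg (u n @[n --> U]).
Proof.
move=> uC; have [|p [_ clp]] := @segment_compact R (- C) C (u @ U) _.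
  suff : U (u @^-1` `[- C, C]%classic) by [].
  by apply: filterE => n; have := uC n; rewrite ler_norml /= in_itv.
apply/cvg_ex; exists p => B Bp.
have [//|UnB] := in_ultra_setVsetC (u @^-1` B) UU.
have [|x [nBx Bx]] // := clp (~` B) B _ Bp.
Qed.

End ultrafilter_limit.

Section limit_operator.
Context d (T : measurableType d) (R : realType).
Variable mu : {measure set T -> \bar R}.
Hypothesis mu_fin : (mu setT < +oo)%E.
Variable L : nat -> (T -> R) -> T -> R.
Hypothesis mL : forall n h, real_Linf mu h -> measurable_fun setT (L n h).
Hypothesis linL : forall n a h g, real_Linf mu h -> real_Linf mu g ->
  L n (fun x => a * h x + g x) = fun x => a * L n h x + L n g x.
Hypothesis bndL : forall n h M, real_Linf mu h -> ae_bounded mu h M ->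
  forall x, `|L n h x| <= M.

Let bmL n h : real_Linf mu h -> real_Linf mu (L n h).
Proof.
move=> bh; split; first exact: mL.
by have [_ [M hM]] := bh; exists M; apply: aeW => x; exact: bndL.
Qed.

Let int_bnd h M B : real_Linf mu h -> ae_bounded mu h M -> measurable B ->
  `|\int[mu]_(x in B) h x| <= M * fine (mu B).
Proof.
move=> bh hM mB; have ih := real_Linf_integrable mu_fin bh mB.
rewrite (le_trans (le_normr_Rintegral mB ih))// -(Rintegral_cst _ mB).
apply: ae_le_Rintegral => //.
- exact: integrable_norm.
- by apply: real_Linf_integrable => //; exact: real_Linf_cst.
- by apply: filterS hM.
Qed.

(** For each h the density of the limit along an ultrafilter of the set
    functions B |-> \int_B L_n h.  Linearity of Phi comes from linearity of
    limits and uniqueness of densities; the third conclusion says that lower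
    bounds that hold for all large n pass to the limit, on any measurable
    set. *)
Lemma limit_operator : exists Phi : (T -> R) -> T -> R,
  [/\ forall h, real_Linf mu h -> real_Linf mu (Phi h),
      forall a h g, real_Linf mu h -> real_Linf mu g ->
        \forall x \ae mu, Phi (fun y => a * h y + g y) x = a * Phi h x + Phi g x
    & forall h u B N, real_Linf mu h -> real_Linf mu u -> measurable B ->
        (forall n, (N <= n)%N -> \forall x \ae mu, B x -> u x <= L n h x) ->
        \forall x \ae mu, B x -> u x <= Phi h x].
Proof.
have [U [UU ooU]] := ultraFilterLemma (eventually_filter).
pose nu h B := lim (\int[mu]_(x in B) L n h x @[n --> U]).
have cnu h B : real_Linf mu h -> measurable B ->
    cvg (\int[mu]_(x in B) L n h x @[n --> U]).
  move=> bh mB; have [_ [M hM]] := bh.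
  apply: (@ultra_bounded_cvg _ _ UU _ (M * fine (mu B))) => n.
  by apply: int_bnd => //; [exact: bmL|apply: aeW => x; exact: bndL].
have nu_bnd h M B : real_Linf mu h -> ae_bounded mu h M -> measurable B ->
    `|nu h B| <= M * fine (mu B).
  move=> bh hM mB; rewrite ler_norml; apply/andP; split.
    apply: limr_ge; first exact: cnu.
    apply: nearW => n; have := int_bnd (bmL n bh) (aeW _ (bndL n bh hM)) mB.
    by rewrite ler_norml => /andP[].
  apply: limr_le; first exact: cnu.
  apply: nearW => n; have := int_bnd (bmL n bh) (aeW _ (bndL n bh hM)) mB.
  by rewrite ler_norml => /andP[].
have dens h : exists psi, real_Linf mu h -> mu.-integrable setT (EFin \o psi) /\
    forall A, measurable A -> \int[mu]_(x in A) psi x = nu h A.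
  have [bh|] := pselect (real_Linf mu h); last by exists h.
  have [_ [M hM]] := bh.
  have [||psi ipsi psiE] := @dominated_density _ _ _ mu mu_fin (nu h) M.
  - move=> A B mA mB AB0; rewrite /nu -limD; [|exact: cnu|exact: cnu].
    congr (lim _); congr (_ @ U); apply/funext => n /=.
    rewrite Rintegral_setU//; last by apply/disj_set2P.
    by apply: real_Linf_integrable => //; [exact: bmL|exact: measurableU].
  - by move=> A mA; exact: nu_bnd.
  - by exists psi.
have [Phi PhiP] := choice dens.
have Phi_lb h u B N : real_Linf mu h -> real_Linf mu u -> measurable B ->
        (forall n, (N <= n)%N -> \forall x \ae mu, B x -> u x <= L n h x) ->
        \forall x \ae mu, B x -> u x <= Phi h x.
  move=> bh bu mB uL; have [iPhi PhiE] := PhiP h bh.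
  apply: Rintegral_ae_le => //; first exact: real_Linf_integrable.
    exact: integrableS iPhi.
  move=> A mA AB; rewrite PhiE//; apply: limr_ge; first exact: cnu.
  apply: ooU; exists N => // n /uL uLn.
  apply: (ae_le_Rintegral mA).
  - exact: real_Linf_integrable.
  - by apply: real_Linf_integrable => //; exact: bmL.
  - by apply: filterS uLn => x uLn /AB.
have Phi_lin a h g : real_Linf mu h -> real_Linf mu g ->
  \forall x \ae mu, Phi (fun y => a * h y + g y) x = a * Phi h x + Phi g x.
  move=> bh bg; pose k := fun x => a * h x + g x.
  have bk : real_Linf mu k by exact: real_Linf_lin.
  have [iPh PhE] := PhiP h bh; have [iPg PgE] := PhiP g bg.
  have [iPk PkE] := PhiP k bk.
  have isum : mu.-integrable setT (EFin \o (fun x => a * Phi h x + Phi g x)).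
    rewrite (_ : _ \o _ = (fun x => a%:E * (Phi h x)%:E + (Phi g x)%:E)%E)//.
    by apply: integrableD => //; exact: integrableZl.
  have E A : measurable A -> \int[mu]_(x in A) Phi k x =
      \int[mu]_(x in A) (a * Phi h x + Phi g x).
    move=> mA; have iS f : mu.-integrable setT (EFin \o f) ->
      mu.-integrable A (EFin \o f) by apply: integrableS.
    rewrite RintegralD//; [|exact: (integrableZl mA a (iS _ iPh))|exact: iS].
    rewrite RintegralZl ?PkE ?PhE ?PgE//; last exact: iS.
    have c1 := cnu _ _ bh mA; have c2 := cnu _ _ bg mA.
    apply: cvg_lim => //; rewrite (_ : (fun n => _) =
        fun n => a * \int[mu]_(x in A) L n h x + \int[mu]_(x in A) L n g x).
      by apply: cvgD => //; apply: cvgM => //; exact: cvg_cst.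
    apply/funext => n; rewrite linL//.
    have iLh := real_Linf_integrable mu_fin (bmL n bh) mA.
    have iLg := real_Linf_integrable mu_fin (bmL n bg) mA.
    by rewrite RintegralD ?RintegralZl//; exact: (integrableZl mA a iLh).
  have le1 : \forall x \ae mu, setT x -> Phi k x <= a * Phi h x + Phi g x.
    by apply: Rintegral_ae_le => // A mA _; rewrite E.
  have le2 : \forall x \ae mu, setT x -> a * Phi h x + Phi g x <= Phi k x.
    by apply: Rintegral_ae_le => // A mA _; rewrite E.
  by apply: filterS2 le1 le2 => x l1 l2; apply/eqP; rewrite eq_le l1// l2.
exists Phi; split=> //.
move=> h bh; have [iPhi _] := PhiP h bh; split.
  exact/measurable_EFinP/(measurable_int mu).
have [_ [M hM]] := bh; exists M.
have b0 := real_Linf_cst mu 0.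
have bN : real_Linf mu (fun x => - 1 * h x + cst 0 x) by exact: real_Linf_lin.
have lo : \forall x \ae mu, setT x -> - M <= Phi h x.
  apply: (Phi_lb h (cst (- M)) setT 0%N) => //; first exact: real_Linf_cst.
  move=> n _; apply: aeW => x _ /=.
  by have := bndL n bh hM x; rewrite ler_norml => /andP[].
have up : \forall x \ae mu, setT x -> - M <= Phi (fun x => - 1 * h x + cst 0 x) x.
  apply: (Phi_lb _ (cst (- M)) setT 0%N) => //; first exact: real_Linf_cst.
  move=> n _; apply: aeW => x _ /=.
  have Nh : ae_bounded mu (fun x => - 1 * h x + cst 0 x) M.
    by apply: filterS hM => y; rewrite mulN1r addr0 normrN.
  by have := bndL n bN Nh x; rewrite ler_norml => /andP[].
have P0 : \forall x \ae mu, Phi (fun y => - 1 * cst 0 y + cst 0 y) x =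
    - 1 * Phi (cst 0) x + Phi (cst 0) x.
  exact: Phi_lin.
have lin := Phi_lin (- 1) h (cst 0) bh b0.
apply: filterS3 (filterI lo up) lin P0 => x [/(_ I) lox /(_ I) upx].
rewrite (_ : (fun y => - 1 * cst 0 y + cst 0 y) = cst 0); last first.
  by apply/funext => y /=; rewrite mulr0 addr0.
by move=> linx P0x; rewrite ler_norml lox/=; lra.
Qed.

End limit_operator.

(** * Averages over sets where a given function is nearly maximal *)

Section averages.
Context d (T : measurableType d) (R : realType).
Variable mu : {measure set T -> \bar R}.
Hypothesis mu_fin : (mu setT < +oo)%E.
Implicit Types (A E : set T) (h k : T -> R).

Definition average A h : R := (\int[mu]_(x in A) h x) / fine (mu A).

Let fin_mu A : measurable A -> mu A \is a fin_num.
Proof. exact: lty_fin_num_fun. Qed.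

Lemma le_average A h c : measurable A -> (0 < mu A)%E -> real_Linf mu h ->
  (\forall x \ae mu, A x -> c <= h x) -> c <= average A h.
Proof.
move=> mA A0 bh ch; rewrite /average ler_pdivlMr; last first.
  by rewrite fine_gt0// A0/= -ge0_fin_numE// fin_mu.
rewrite -Rintegral_cst//; apply: ae_le_Rintegral => //.
  by apply: (real_Linf_integrable mu_fin (real_Linf_cst mu c)).
exact: real_Linf_integrable.
Qed.

Lemma average_lin A a h k : measurable A -> real_Linf mu h -> real_Linf mu k ->
  average A (fun x => a * h x + k x) = a * average A h + average A k.
Proof.
move=> mA bh bk; have ih := real_Linf_integrable mu_fin bh mA.
have ik := real_Linf_integrable mu_fin bk mA.
rewrite /average RintegralD//; last exact: (integrableZl mA a ih).
by rewrite RintegralZl// mulrDl mulrA.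
Qed.

Lemma average_bound A h M : measurable A -> (0 < mu A)%E -> real_Linf mu h ->
  ae_bounded mu h M -> `|average A h| <= M.
Proof.
move=> mA A0 bh hM; have b0 := real_Linf_cst mu (0 : R).
have lo : - M <= average A h.
  by apply: le_average => //; apply: filterS hM => x; rewrite ler_norml => /andP[].
have bN := real_Linf_lin (-1) bh b0.
have : - M <= average A (fun x => -1 * h x + cst 0 x).
  apply: le_average => //; apply: filterS hM => x.
  by rewrite ler_norml mulN1r addr0 => /andP[_]; rewrite lerN2.
rewrite average_lin// [average A (cst 0)](_ : _ = 0); last first.
  by rewrite /average Rintegral_cst// mul0r mul0r.
by rewrite mulN1r addr0 lerN2 ler_norml lo.
Qed.

(** The value s is chosen within eps of the supremum of the c such that k >= c on
    a non-negligible part of E, and A is the part of E where k >= s. *)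
Lemma near_ess_sup E k eps : measurable E -> (0 < mu E)%E -> real_Linf mu k ->
  0 < eps -> exists A s, [/\ measurable A, A `<=` E, (0 < mu A)%E,
    forall x, A x -> s <= k x & \forall x \ae mu, E x -> k x <= s + eps].
Proof.
move=> mE E0 [mk [M kM]] eps0.
pose Ec c := E `&` [set x | c <= k x].
have mEc c : measurable (Ec c).
  by apply: measurable_fun_le => //; exact: measurable_funTS.
pose S := [set c | (0 < mu (Ec c))%E].
have S0 : S (- M).
  rewrite /S/= (_ : mu (Ec _) = mu E)//.
  have : \forall x \ae mu, E x -> Ec (- M) x.
    by apply: filterS kM => x + Ex; rewrite ler_norml => /andP[kx _]; split.
  move=> h; apply/eqP; rewrite eq_le le_measure ?inE//=; last exact: subIsetl.
  have [N [mN N0 hN]] := h.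
  rewrite -[leRHS]adde0 -[X in (_ + X)%E]N0.
  apply: (le_trans _ (measureU2 _ (mEc (- M)) mN)); apply: le_measure; rewrite ?inE//.
    exact: measurableU.
  move=> x Ex; have [nx|?] := pselect (Ec (- M) x); [by left|right; apply: hN => /=].
  by move/(_ Ex).
have ubS : ubound S M.
  move=> c; rewrite /S/= => Ec0; rewrite leNgt; apply/negP => Mc.
  move: Ec0; apply/negP; rewrite -leNgt measure_le0.
  have [N [mN N0 hN]] := kM.
  apply/eqP; apply: (subset_measure0 (mEc c) mN _ N0) => x [_ cx]; apply: hN => /= kx.
  by have := le_lt_trans (le_trans cx (le_trans (ler_norm _) kx)) Mc; rewrite ltxx.
have hS : has_sup S by split; [exists (- M)|exists M].
have [s Ss hs] := sup_adherent eps0 hS.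
exists (Ec s), s; split => //; [exact: subIsetl|by move=> x []|].
have nS : ~ S (s + eps).
  move=> /(ub_le_sup hS.2); rewrite -lerBrDr => /(lt_le_trans hs).
  by rewrite ltxx.
exists (Ec (s + eps)); split => //.
  by apply/eqP; rewrite -measure_le0 leNgt; apply/negP.
move=> x /= /not_implyP[Ex /negP]; rewrite -ltNge => /ltW h.
by split.
Qed.

Lemma measurable_fun_countable (I : countType) (idx : T -> I) (F : I -> R) :
  (forall i, measurable (idx @^-1` [set i])) ->
  measurable_fun setT (fun x => F (idx x)).
Proof.
move=> midx _ Y mY; rewrite setTI.
rewrite (_ : _ @^-1` _ =
    \bigcup_i (if i \in F @^-1` Y then idx @^-1` [set i] else set0)).
  by apply: countable_bigcupT_measurable => // i; case: ifP.
apply/seteqP; split=> x /=.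
  by exists (idx x) => //; rewrite mem_set.
by move=> [i _]; case: ifPn => // /set_mem /= Yi ->.
Qed.

End averages.

Section extremal_limit_operator.
Context d (T : measurableType d) (R : realType).
Variable mu : {measure set T -> \bar R}.
Hypothesis mu_fin : (mu setT < +oo)%E.
Hypothesis mu_gt0 : (0 < mu setT)%E.
Variables (I : countType) (idx : nat -> T -> I).
Hypothesis midx : forall n i, measurable (idx n @^-1` [set i]).
Implicit Types (h k : T -> R).

Let ae_gt0_cell : \forall x \ae mu, forall n,
  (0 < mu (idx n @^-1` [set idx n x]))%E.
Proof.
apply/ae_foralln => n.
have : \forall x \ae mu, forall i, ~~ (0 < mu (idx n @^-1` [set i]))%E -> idx n x <> i.
  apply: ae_forall_countable => i.
  have [c0|c0] := boolP (0 < mu (idx n @^-1` [set i]))%E; first exact: aeW.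
  exists (idx n @^-1` [set i]); split => //.
    by apply/eqP; rewrite -measure_le0 leNgt.
  by move=> x /= /not_implyP[_ /contrapT].
by apply: filterS => x h; apply: contrapT => /negP /h; apply.
Qed.

(** Phi is the limit of averaging, over each cell of idx n, on a subset where k is
    nearly maximal.  Functions oscillating little on small cells are fixed.  On
    the set where k + 1 / (m + 1) stays below the nearly maximal values for
    all n >= m, the function Phi k is at least k + 1 / (m + 1), so if
    Phi k = k this set is negligible: this is the last conclusion. *)
Lemma extremal_limit_operator k : real_Linf mu k ->
  exists Phi : (T -> R) -> T -> R,
  [/\ [/\ forall h, real_Linf mu h -> real_Linf mu (Phi h),
      forall a h g, real_Linf mu h -> real_Linf mu g ->
        \forall x \ae mu, Phi (fun y => a * h y + g y) x = a * Phi h x + Phi g x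
    & forall h c, real_Linf mu h ->
        (\forall x \ae mu, c <= h x) -> \forall x \ae mu, c <= Phi h x],
     forall h, real_Linf mu h ->
       (forall eps : R, 0 < eps -> exists N, forall n, (N <= n)%N ->
         \forall x \ae mu, \forall y \ae mu, idx n y = idx n x ->
           `|h y - h x| <= eps) ->
       \forall x \ae mu, Phi h x = h x
   & (\forall x \ae mu, Phi k x = k x) ->
     \forall x \ae mu, forall eps : R, 0 < eps -> exists n,
       \forall y \ae mu, idx n y = idx n x -> k y <= k x + eps].
Proof.
move=> bk; have [mk _] := bk.
pose J n i := idx n @^-1` [set i].
(* On negligible cells A is the whole space, so that every average is a genuine
   one and L n is unital everywhere. *)
have cellP (p : nat * I) : exists q : set T * R, [/\ measurable q.1, (0 < mu q.1)%E &
    (0 < mu (J p.1 p.2))%E -> [/\ q.1 `<=` J p.1 p.2,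
      forall x, q.1 x -> q.2 <= k x &
      \forall x \ae mu, J p.1 p.2 x -> k x <= q.2 + p.1.+1%:R^-1]].
  have [Jp|nJp] := pselect (0 < mu (J p.1 p.2))%E; last first.
    by exists (setT, 0) => /=; split => // /nJp.
  have e0 : 0 < p.1.+1%:R^-1 :> R by rewrite invr_gt0.
  have [A [s [? ? ? ? ?]]] := near_ess_sup (midx _ _) Jp bk e0.
  by exists (A, s).
have [q qP] := choice cellP.
pose A n i := (q (n, i)).1; pose s n i := (q (n, i)).2.
have mA n i : measurable (A n i) by have [] := qP (n, i).
have A0 n i : (0 < mu (A n i))%E by have [] := qP (n, i).
have AJ n i : (0 < mu (J n i))%E -> A n i `<=` J n i.
  by move=> J0; have [_ _ /(_ J0)[]] := qP (n, i).
have As n i x : (0 < mu (J n i))%E -> A n i x -> s n i <= k x.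
  by move=> J0; have [_ _ /(_ J0)[_ + _]] := qP (n, i); apply.
have Js n i : (0 < mu (J n i))%E ->
    \forall x \ae mu, J n i x -> k x <= s n i + n.+1%:R^-1.
  by move=> J0; have [_ _ /(_ J0)[]] := qP (n, i).
pose L n h x := average mu (A n (idx n x)) h.
have [|||Phi [bmPhi linPhi lbPhi]] := @limit_operator _ _ _ mu mu_fin L.
- move=> n h bh;
  exact: (@measurable_fun_countable _ _ _ I (idx n)
    (fun i => average mu (A n i) h)).
- by move=> n a h g bh bg; apply/funext => x; exact: average_lin.
- by move=> n h M bh hM x; exact: average_bound.
exists Phi; split; [split=> //| |].
- move=> h c bh ch; have : \forall x \ae mu, setT x -> cst c x <= Phi h x.
    apply: (lbPhi h (cst c) setT 0%N) => //; first exact: real_Linf_cst.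
    by move=> n _; apply: aeW => x _; apply: le_average => //; apply: filterS ch => z cz _.
  by apply: filterS => x; apply.
- move=> h bh hosc.
  have lo g : real_Linf mu g -> (forall eps : R, 0 < eps -> exists N, forall n, (N <= n)%N ->
         \forall x \ae mu, \forall y \ae mu, idx n y = idx n x ->
           g x - eps <= g y) -> \forall x \ae mu, g x <= Phi g x.
    move=> bg gosc; have /ae_foralln : forall m, \forall x \ae mu,
        g x - m.+1%:R^-1 <= Phi g x.
      move=> m; have m0 : 0 < m.+1%:R^-1 :> R by rewrite invr_gt0.
      have [N gN] := gosc _ m0.
      have bu : real_Linf mu (fun x => 1 * g x + cst (- m.+1%:R^-1) x).
        by apply: real_Linf_lin => //; exact: real_Linf_cst.
      have : \forall x \ae mu, setT x -> 1 * g x + cst (- m.+1%:R^-1) x <= Phi g x.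
        apply: (lbPhi g _ setT N) => // n Nn.
        apply: filterS2 ae_gt0_cell (gN n Nn) => x J0 gx _.
        rewrite mul1r; apply: le_average => //; apply: filterS gx => y + Ay.
        by apply; exact: (AJ _ _ (J0 n)) Ay.
      by apply: filterS => x /(_ Logic.I); rewrite mul1r.
    apply: filterS => x hx; apply/ler_addgt0Pr => e e0.
    have [M _ /(_ M (leqnn M)) /= Me] := near_infty_natSinv_lt (PosNum e0).
    by have := hx M; rewrite lerBlDr => /le_trans; apply; rewrite lerD2l ltW.
  have b0 := real_Linf_cst mu (0 : R).
  have lo1 : \forall x \ae mu, h x <= Phi h x.
    apply: lo => // e e0; have [N hN] := hosc e e0; exists N => n /hN.
    apply: filterS => x; apply: filterS => y + yx => /(_ yx).
    by rewrite ler_norml => /andP[? _]; lra.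
  have lo2 : \forall x \ae mu, -1 * h x + cst 0 x <= Phi (fun x => -1 * h x + cst 0 x) x.
    apply: lo; first exact: real_Linf_lin.
    move=> e e0; have [N hN] := hosc e e0; exists N => n /hN.
    apply: filterS => x; apply: filterS => y + yx => /(_ yx) /=.
    by rewrite ler_norml => /andP[_ ?]; lra.
  have P0 := linPhi 1 _ _ b0 b0.
  rewrite (_ : (fun y => 1 * _ y + _) = cst 0) in P0; last first.
    by apply/funext => y /=; rewrite mulr0 addr0.
  apply: filterS3 (filterI lo1 lo2) (linPhi (-1) _ _ bh b0) P0.
  move=> x [l1 l2] l3 P0x; rewrite l3 /= in l2.
  by apply/eqP; rewrite eq_le; apply/andP; split; lra.
- move=> Phik.
  have B0 m : \forall x \ae mu, exists2 n, (m <= n)%N & s n (idx n x) < k x + m.+1%:R^-1.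
    pose u x := 1 * k x + cst m.+1%:R^-1 x.
    have bu : real_Linf mu u by apply: real_Linf_lin => //; exact: real_Linf_cst.
    pose B := \bigcap_(n in [set n | (m <= n)%N]) [set x | u x <= s n (idx n x)].
    have mB : measurable B.
      apply: bigcap_measurable; first by exists m => /=.
      move=> n _; rewrite -[X in measurable X]setTI.
      apply: measurable_fun_le => //; first by case: bu.
      exact: measurable_fun_countable.
    have : \forall x \ae mu, B x -> u x <= Phi k x.
      apply: (lbPhi k u B m) => // n mn; apply: filterS ae_gt0_cell => x J0 Bx.
      apply: (le_trans (Bx n mn)); apply: le_average => //.
      by apply: aeW => y; exact: As (J0 n).
    apply: filterS2 Phik => x -> uk; apply: contrapT => nex.
    suff /uk : B x by rewrite /u mul1r/= gerDl leNgt invr_gt0 ltr0n.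
    move=> n mn /=; rewrite leNgt; apply/negP => su; apply: nex; exists n => //.
    by move: su; rewrite /u mul1r.
  have cells : \forall x \ae mu, forall n, \forall y \ae mu, idx n y = idx n x ->
      k y <= s n (idx n x) + n.+1%:R^-1.
    by apply: filterS ae_gt0_cell => x J0 n; exact: Js (J0 n).
  have /ae_foralln {}B0 := B0.
  apply: filterS2 B0 cells => x Bx cx e e0.
  have e20 : 0 < e / 2 by rewrite divr_gt0.
  have [M _ /(_ M (leqnn M))] := near_infty_natSinv_lt (PosNum e20).
  rewrite [X in _ < X]/(e / 2) => Me.
  have [n Mn sn] := Bx M; exists n; apply: filterS (cx n) => y + yx => /(_ yx) ky.
  have nM : n.+1%:R^-1 <= M.+1%:R^-1 :> R by rewrite lef_pV2 ?posrE// ler_nat.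
  have {}Me : M.+1%:R^-1 < e / 2 by exact: Me.
  move: ky sn nM Me; move: (n.+1%:R^-1 : R) (M.+1%:R^-1 : R) (s n _) => a b c.
  by move=> ? ? ? ?; lra.
Qed.

End extremal_limit_operator.

Local Open Scope complex_scope.
Local Open Scope quotient_scope.

(** * The operator norm of a complex matrix *)

Section complex_parts.
Variable R : realType.
Implicit Types z w : R[i].

Lemma cmod_sqr z : cmod z ^+ 2 = complex.Re z ^+ 2 + complex.Im z ^+ 2.
Proof.
by case: z => a b; rewrite /cmod normc_def/= sqr_sqrtr// addr_ge0// sqr_ge0.
Qed.

Lemma cReD z w : complex.Re (z + w) = complex.Re z + complex.Re w.
Proof. by case: z w => [? ?] [? ?]. Qed.

Lemma cImD z w : complex.Im (z + w) = complex.Im z + complex.Im w.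
Proof. by case: z w => [? ?] [? ?]. Qed.

Lemma cReM z w : complex.Re (z * w) =
  complex.Re z * complex.Re w - complex.Im z * complex.Im w.
Proof. by case: z w => [? ?] [? ?]. Qed.

Lemma cImM z w : complex.Im (z * w) =
  complex.Re z * complex.Im w + complex.Im z * complex.Re w.
Proof. by case: z w => [? ?] [? ?]. Qed.

Lemma cRe_sum (I : Type) (r : seq I) (f : I -> R[i]) :
  complex.Re (\sum_(i <- r) f i) = \sum_(i <- r) complex.Re (f i).
Proof. exact: (big_morph _ cReD erefl). Qed.

Lemma cIm_sum (I : Type) (r : seq I) (f : I -> R[i]) :
  complex.Im (\sum_(i <- r) f i) = \sum_(i <- r) complex.Im (f i).
Proof. exact: (big_morph _ cImD erefl). Qed.

Lemma complex_eqP z w : complex.Re z = complex.Re w ->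
  complex.Im z = complex.Im w -> z = w.
Proof. by case: z w => [? ?] [? ?] /= -> ->. Qed.

Lemma Re_le_cmod z : `|complex.Re z| <= cmod z.
Proof.
rewrite -(@ler_pXn2r _ 2)// ?nnegrE ?cmod_ge0//.
by rewrite cmod_sqr real_normK ?num_real// lerDl sqr_ge0.
Qed.

Lemma Im_le_cmod z : `|complex.Im z| <= cmod z.
Proof.
rewrite -(@ler_pXn2r _ 2)// ?nnegrE ?cmod_ge0//.
by rewrite cmod_sqr real_normK ?num_real// lerDr sqr_ge0.
Qed.

Lemma cmod_le_ReIm z : cmod z <= `|complex.Re z| + `|complex.Im z|.
Proof.
rewrite -(@ler_pXn2r _ 2)// ?nnegrE ?cmod_ge0 ?addr_ge0//.
rewrite cmod_sqr sqrrD !real_normK ?num_real// -addrA lerD2l lerDr.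
by rewrite mulrn_wge0// mulr_ge0.
Qed.

End complex_parts.

Section operator_norm.
Variables (R : realType) (n : nat).
Implicit Types (A : 'M[R[i]]_n) (a b c d : 'I_n -> R) (v : 'cV[R[i]]_n) (C : R).

Definition re_mul A a b (i : 'I_n) : R :=
  \sum_j (complex.Re (A i j) * a j - complex.Im (A i j) * b j).
Definition im_mul A a b (i : 'I_n) : R :=
  \sum_j (complex.Re (A i j) * b j + complex.Im (A i j) * a j).

(** With v = a + i b and w = c + i d, this is
    C (|v|^2 + |w|^2) - 2 Re <w, A v>.  It is a polynomial in the coordinates, which
    makes the passage from rational to real vectors a matter of continuity. *)
Definition norm_form A C a b c d : R :=
  \sum_i (C * (a i ^+ 2 + b i ^+ 2 + c i ^+ 2 + d i ^+ 2)
          - 2 * (c i * re_mul A a b i + d i * im_mul A a b i)).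

Let cvec a b : 'cV[R[i]]_n := \col_i (a i +i* b i).

Let Re_mulmx A a b i : complex.Re ((A *m cvec a b) i 0) = re_mul A a b i.
Proof. by rewrite mxE cRe_sum; apply: eq_bigr => j _; rewrite cReM !mxE. Qed.

Let Im_mulmx A a b i : complex.Im ((A *m cvec a b) i 0) = im_mul A a b i.
Proof. by rewrite mxE cIm_sum; apply: eq_bigr => j _; rewrite cImM !mxE. Qed.

Let cvecE v : v = cvec (fun i => complex.Re (v i 0)) (fun i => complex.Im (v i 0)).
Proof. by apply/colP => i; rewrite mxE; case: (v i 0). Qed.

Lemma l2norm_sqr v : l2norm v ^+ 2 =
  \sum_i (complex.Re (v i 0) ^+ 2 + complex.Im (v i 0) ^+ 2).
Proof.
rewrite /l2norm sqr_sqrtr; first by apply: eq_bigr => i _; rewrite cmod_sqr.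
by apply: sumr_ge0 => i _; rewrite sqr_ge0.
Qed.

Lemma l2norm_ge0 v : 0 <= l2norm v. Proof. exact: sqrtr_ge0. Qed.

Lemma l2normZ (r : R) v : 0 <= r -> l2norm (r%:C *: v) = r * l2norm v.
Proof.
move=> r0; apply/eqP; rewrite -(@eqrXn2 _ 2)// ?l2norm_ge0 ?mulr_ge0 ?l2norm_ge0//.
rewrite exprMn !l2norm_sqr mulr_sumr; apply/eqP/eq_bigr => i _.
by rewrite mxE cReM cImM/=; ring.
Qed.

Lemma cmod_entry_le v i : cmod (v i 0) <= l2norm v.
Proof.
rewrite -(@ler_pXn2r _ 2)// ?nnegrE ?cmod_ge0 ?l2norm_ge0//.
rewrite l2norm_sqr cmod_sqr (bigD1 i)//= lerDl; apply: sumr_ge0 => j _.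
by rewrite addr_ge0// sqr_ge0.
Qed.

Let opnorm_has_sup A :
  has_sup [set l2norm (A *m v) | v in [set v | l2norm v <= 1]].
Proof.
split.
  exists (l2norm (A *m 0)), 0 => //=.
  by rewrite /l2norm big1 ?sqrtr0// => i _; rewrite mxE cmod0 expr0n.
exists (Num.sqrt (\sum_i (\sum_j cmod (A i j)) ^+ 2)) => _ [v /= v1 <-].
rewrite /l2norm ler_wsqrtr//; apply: ler_sum => i _.
rewrite ler_pXn2r// ?nnegrE ?cmod_ge0//; last first.
  by apply: sumr_ge0 => j _; exact: cmod_ge0.
rewrite mxE; apply: (@le_trans _ _ (\sum_j cmod (A i j * v j 0))).
  elim/big_ind2 : _ => [|x x' y y' xx yy|//]; first by rewrite cmod0.
  by rewrite (le_trans (cmodD _ _))// lerD.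
apply: ler_sum => j _; rewrite cmodM ler_piMr ?cmod_ge0//.
exact: le_trans (cmod_entry_le _ _) v1.
Qed.

Lemma opnorm_ge0 A : 0 <= opnorm A.
Proof.
have [[_ [v v1 _]] ub] := opnorm_has_sup A.
apply: (@le_trans _ _ (l2norm (A *m v))); first exact: l2norm_ge0.
by apply: ub_le_sup => //; exists v.
Qed.

Lemma opnorm_bound A v : l2norm (A *m v) <= opnorm A * l2norm v.
Proof.
have [v0|v0] := eqVneq (l2norm v) 0.
  have -> : v = 0.
    apply/colP => i; rewrite mxE; have := cmod_entry_le v i.
    rewrite v0 => h; have {h}: cmod (v i 0) = 0 by apply/eqP; rewrite eq_le h cmod_ge0.
    by move=> /(congr1 (fun x => x%:C)); rewrite cmodE => /normr0_eq0.
  rewrite mulmx0 [X in X <= _](_ : _ = 0) ?mulr_ge0 ?opnorm_ge0 ?l2norm_ge0//.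
  by rewrite /l2norm big1 ?sqrtr0// => i _; rewrite mxE cmod0 expr0n.
have vp : 0 < l2norm v by rewrite lt_def v0 l2norm_ge0.
rewrite -ler_pdivrMr// mulrC -l2normZ ?invr_ge0 ?l2norm_ge0//.
rewrite scalemxAr; apply: ub_le_sup; first exact: (opnorm_has_sup A).2.
by exists ((l2norm v)^-1%:C *: v) => //=; rewrite l2normZ ?invr_ge0 ?l2norm_ge0// mulVf.
Qed.

(** If |A| <= C, complete the square in w.  Conversely take w = A v / C. *)
Lemma opnorm_norm_form A C : 0 < C ->
  opnorm A <= C <-> forall a b c d, 0 <= norm_form A C a b c d.
Proof.
move=> C0; split=> [AC a b c d|h].
  pose v := cvec a b.
  have : l2norm (A *m v) ^+ 2 <= (C * l2norm v) ^+ 2.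
    rewrite ler_pXn2r// ?nnegrE ?l2norm_ge0 ?mulr_ge0 ?l2norm_ge0 ?(ltW C0)//.
    by rewrite (le_trans (opnorm_bound _ _))// ler_wpM2r ?l2norm_ge0.
  rewrite exprMn !l2norm_sqr => le1.
  have {le1} : C^-1 * \sum_i (re_mul A a b i ^+ 2 + im_mul A a b i ^+ 2) <=
          C * \sum_i (a i ^+ 2 + b i ^+ 2).
    rewrite ler_pdivrMl// mulrA -expr2.
    under eq_bigr do rewrite -Re_mulmx -Im_mulmx.
    rewrite [X in C ^+ 2 * X](_ : _ =
        \sum_i (complex.Re (v i 0) ^+ 2 + complex.Im (v i 0) ^+ 2))//.
    by apply: eq_bigr => i _; rewrite !mxE.
  rewrite !mulr_sumr => le1; rewrite /norm_form.
  rewrite (@le_trans _ _ (\sum_i (C * (a i ^+ 2 + b i ^+ 2)) -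
    \sum_i (C^-1 * (re_mul A a b i ^+ 2 + im_mul A a b i ^+ 2))))// ?subr_ge0//.
  rewrite -sumrB; apply: ler_sum => i _.
  set U := re_mul _ _ _ _; set V := im_mul _ _ _ _.
  rewrite -subr_ge0 [X in 0 <= X](_ : _ =
    C * ((c i - C^-1 * U) ^+ 2 + (d i - C^-1 * V) ^+ 2)).
    by rewrite mulr_ge0 ?(ltW C0)// addr_ge0// sqr_ge0.
  by field; rewrite gt_eqF.
apply: sup_le_ub; first exact: (opnorm_has_sup A).1.
move=> _ [v v1 <-]; rewrite -(@ler_pXn2r _ 2)// ?nnegrE ?l2norm_ge0 ?(ltW C0)//.
pose a i := complex.Re (v i 0); pose b i := complex.Im (v i 0).
have := h a b (fun i => C^-1 * re_mul A a b i) (fun i => C^-1 * im_mul A a b i).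
have v1' : \sum_i (a i ^+ 2 + b i ^+ 2) <= 1.
  by rewrite -l2norm_sqr -[leRHS](expr1n _ 2) ler_pXn2r ?nnegrE ?l2norm_ge0.
rewrite (cvecE v) l2norm_sqr => h0.
under eq_bigr do rewrite Re_mulmx Im_mulmx.
set S := \sum_i _; have : C * \sum_i (a i ^+ 2 + b i ^+ 2) - C^-1 * S >= 0.
  rewrite (le_trans h0)// !mulr_sumr -sumrB; apply: ler_sum => i _.
  rewrite le_eqVlt; apply/orP; left; apply/eqP.
  by rewrite /a /b; field; rewrite gt_eqF.
rewrite subr_ge0 ler_pdivrMl// mulrA -expr2 => /le_trans; apply.
by rewrite ler_piMr ?sqr_ge0.
Qed.

End operator_norm.

Lemma rat_approx (R : realType) (x : R) :
  exists u : nat -> rat, (ratr (u n) : R) @[n --> \oo] --> x.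
Proof.
have H k : exists q : rat, `|x - ratr q| < k.+1%:R^-1.
  have [|q] := @rat_in_itvoo R (x - k.+1%:R^-1) (x + k.+1%:R^-1) _.
    by rewrite ltrD2l gtrN.
  by rewrite in_itv/= => qx; exists q; rewrite distrC ltr_distl.
have [u uP] := choice H; exists u.
apply/cvgrPdist_lt => e e0; near=> k.
by rewrite (lt_trans (uP k))//; near: k; exact: near_infty_natSinv_lt (PosNum e0).
Unshelve. all: by end_near. Qed.

(** Rational vectors suffice; for matrices depending on a point x they reduce a
    bound on the norm to countably many inequalities, each of which may fail on
    a null set. *)
Lemma norm_form_dense (R : realType) n (A : 'M[R[i]]_n) C :
  (forall a b c d : {ffun 'I_n -> rat}, 0 <= norm_form A C
     (fun i => ratr (a i)) (fun i => ratr (b i))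
     (fun i => ratr (c i)) (fun i => ratr (d i))) ->
  forall a b c d, 0 <= norm_form A C a b c d.
Proof.
move=> h a b c d.
have seq_of (f : 'I_n -> R) : exists u : nat -> {ffun 'I_n -> rat},
    forall i, (ratr (u k i) : R) @[k --> \oo] --> f i.
  have [u uP] := choice (fun i => rat_approx (f i)).
  exists (fun k => [ffun i => u i k]) => i.
  by under eq_cvg do rewrite ffunE; exact: uP.
have [a_ ha] := seq_of a; have [b_ hb] := seq_of b.
have [c_ hc] := seq_of c; have [d_ hd] := seq_of d.
suff lim : norm_form A C (fun i => ratr (a_ k i)) (fun i => ratr (b_ k i))
     (fun i => ratr (c_ k i)) (fun i => ratr (d_ k i)) @[k --> \oo] -->
     norm_form A C a b c d.
  by apply: (cvgr_to_ge lim); apply: nearW => k; exact: h.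
have cst_mul (r l : R) (u : nat -> R) : u k @[k --> \oo] --> l ->
    r * u k @[k --> \oo] --> r * l.
  by move=> ul; apply: cvgM => //; exact: cvg_cst.
have sqr_cvg (l : R) (u : nat -> R) : u k @[k --> \oo] --> l ->
    u k ^+ 2 @[k --> \oo] --> l ^+ 2.
  by move=> ul; rewrite expr2; under eq_fun do rewrite expr2; exact: cvgM.
have sum_cvg (u : 'I_n -> nat -> R) (l : 'I_n -> R) :
    (forall i, u i k @[k --> \oo] --> l i) ->
    \sum_i u i k @[k --> \oo] --> \sum_i l i.
  by move=> ul; apply: cvg_big => //; exact: add_continuous.
rewrite /norm_form; apply: (sum_cvg) => i; apply: cvgB.
  by apply: (cst_mul); do !apply: cvgD; exact: sqr_cvg.
have re_cvg : re_mul A (fun i => ratr (a_ k i)) (fun i => ratr (b_ k i)) i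
    @[k --> \oo] --> re_mul A a b i.
  by apply: (sum_cvg) => j; apply: cvgB; exact: cst_mul.
have im_cvg : im_mul A (fun i => ratr (a_ k i)) (fun i => ratr (b_ k i)) i
    @[k --> \oo] --> im_mul A a b i.
  by apply: (sum_cvg) => j; apply: cvgD; exact: cst_mul.
by apply: (cst_mul); apply: cvgD; exact: cvgM.
Qed.

(** * Complex L^oo and complete contractivity *)

Section Linf_classes.
Context d (T : measurableType d) (R : realType).
Variable mu : {measure set T -> \bar R}.
Local Notation W := (Linf mu).
Implicit Types (g h : W).

Lemma repr_pi (f : Linf_fun mu) : \forall x \ae mu, repr (\pi_W f) x = f x.
Proof. by apply: filterS (is_class_of_pi f). Qed.

Lemma reprD g h : \forall x \ae mu, repr (g + h) x = repr g x + repr h x.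
Proof.
have := repr_pi (repr g + repr h).
rewrite (_ : \pi_W _ = g + h)//.
by rewrite (Quotient.pi_add _ (repr g) (repr h)) !reprK.
Qed.

Lemma reprZ a g : \forall x \ae mu, repr (a *: g) x = a * repr g x.
Proof. exact: repr_pi. Qed.

Lemma repr_sum (I : eqType) (r : seq I) (c : I -> R[i]) (F : I -> W) :
  \forall x \ae mu, repr (\sum_(i <- r) c i *: F i) x =
                    \sum_(i <- r) c i * repr (F i) x.
Proof.
elim: r => [|i r IH].
  have := reprZ 0 0; rewrite big_nil scale0r; apply: filterS => x ->.
  by rewrite big_nil mul0r.
rewrite big_cons; have rD := reprD (c i *: F i) (\sum_(j <- r) c j *: F j).
apply: filterS3 rD (reprZ (c i) (F i)) IH => x.
by rewrite big_cons => -> -> ->.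
Qed.

Lemma repr_real_Linf g : real_Linf mu (fun x => complex.Re (repr g x)) /\
  real_Linf mu (fun x => complex.Im (repr g x)).
Proof.
have /asboolP[[mr mi] [M hM]] := Linf_valP (repr g).
split; (split=> //; exists M; apply: filterS hM => x; apply: le_trans).
  exact: Re_le_cmod.
exact: Im_le_cmod.
Qed.

Lemma Linf_of_real_Linf (h k : T -> R) : real_Linf mu h -> real_Linf mu k ->
  {g : W | is_class_of mu g (fun x => h x +i* k x)}.
Proof.
move=> [mh hM] [mk kN].
have P : (fun x => h x +i* k x) \in Linf_pred mu.
  apply/asboolP; split; first by split.
  have [M {}hM] := hM; have [N {}kN] := kN.
  exists (M + N); apply: filterS2 hM kN => x hM kN.
  by rewrite (le_trans (cmod_le_ReIm _))//= lerD.
exists (\pi_W (MkLinf_fun P)); exact: (is_class_of_pi (MkLinf_fun P)).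
Qed.

End Linf_classes.

(** Comparison of essential suprema through positive real constants only, so that
    infinite and degenerate values are dealt with once. *)
Lemma ess_sup_le_real d (T : measurableType d) (R : realType)
    (mu : {measure set T -> \bar R}) (f g : T -> R) :
  (forall x, 0 <= g x) ->
  (forall C, 0 < C -> (\forall x \ae mu, g x <= C) ->
                      \forall x \ae mu, f x <= C) ->
  (ess_sup mu (fun x => (f x)%:E) <= ess_sup mu (fun x => (g x)%:E))%E.
Proof.
move=> g0 h; have := ess_sup_ge mu (fun x => (g x)%:E).
case: (ess_sup mu (fun x => (g x)%:E)) => [r| |] gr; [|by rewrite leey|].
  apply/ess_supP; have /ae_foralln : forall k, \forall x \ae mu,
      f x <= `|r| + k.+1%:R^-1.
    move=> k; apply: h; first by rewrite ltr_wpDl.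
    apply: filterS gr => x; rewrite lee_fin => /le_trans; apply.
    by rewrite (le_trans (ler_norm _))// lerDl.
  apply: filterS2 gr => x; rewrite !lee_fin => gr fx.
  apply/ler_addgt0Pr => eps e0.
  have [N _ /(_ N (leqnn N)) /= Ne] := near_infty_natSinv_lt (PosNum e0).
  have := fx N; rewrite (ger0_norm (le_trans (g0 x) gr)) => /le_trans; apply.
  by rewrite lerD2l ltW.
by apply/ess_supP; apply: filterS gr => x; rewrite leNgt ltNyr.
Qed.

Section complexification.
Context d (T : measurableType d) (R : realType).
Variable mu : {measure set T -> \bar R}.
Local Notation W := (Linf mu).
Variable Phi : (T -> R) -> T -> R.
Hypothesis bmPhi : forall h, real_Linf mu h -> real_Linf mu (Phi h).
Hypothesis linPhi : forall a h g, real_Linf mu h -> real_Linf mu g ->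
  \forall x \ae mu, Phi (fun y => a * h y + g y) x = a * Phi h x + Phi g x.
Hypothesis lbPhi : forall h c, real_Linf mu h ->
  (\forall x \ae mu, c <= h x) -> \forall x \ae mu, c <= Phi h x.

Let Phi_le h k : real_Linf mu h -> real_Linf mu k ->
  (\forall x \ae mu, h x <= k x) -> \forall x \ae mu, Phi h x <= Phi k x.
Proof.
move=> bh bk hk; have b := real_Linf_lin (-1) bh bk.
have : \forall x \ae mu, 0 <= Phi (fun y => -1 * h y + k y) x.
  by apply: lbPhi => //; apply: filterS hk => x hk; lra.
by apply: filterS2 (linPhi (-1) bh bk) => x -> ; lra.
Qed.

Let Phi_ext h k : real_Linf mu h -> real_Linf mu k ->
  (\forall x \ae mu, h x = k x) -> \forall x \ae mu, Phi h x = Phi k x.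
Proof.
move=> bh bk hk.
have h1 : \forall x \ae mu, Phi h x <= Phi k x.
  by apply: Phi_le => //; apply: filterS hk => x ->.
have h2 : \forall x \ae mu, Phi k x <= Phi h x.
  by apply: Phi_le => //; apply: filterS hk => x ->.
by apply: filterS2 h1 h2 => x l1 l2; apply/eqP; rewrite eq_le l1 l2.
Qed.

Let Phi_cst0 : \forall x \ae mu, Phi (cst 0) x = 0.
Proof.
have b0 := real_Linf_cst mu (0 : R).
apply: filterS (linPhi 1 b0 b0) => x.
rewrite (_ : (fun y => _) = cst 0); first by lra.
by apply/funext => y /=; rewrite mulr0 addr0.
Qed.

Let Re_r (g : W) x := complex.Re (repr g x).
Let Im_r (g : W) x := complex.Im (repr g x).

Let bRe g : real_Linf mu (Re_r g). Proof. by have [] := repr_real_Linf g. Qed.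
Let bIm g : real_Linf mu (Im_r g). Proof. by have [] := repr_real_Linf g. Qed.

Let phi (g : W) : W := sval (Linf_of_real_Linf (bmPhi (bRe g)) (bmPhi (bIm g))).

Let phiE g : \forall x \ae mu,
  Re_r (phi g) x = Phi (Re_r g) x /\ Im_r (phi g) x = Phi (Im_r g) x.
Proof.
rewrite /Re_r /Im_r /phi; case: Linf_of_real_Linf => /= k.
by apply: filterS => x <-.
Qed.

Let Linf_eq (g h : W) : (\forall x \ae mu, Re_r g x = Re_r h x /\ Im_r g x = Im_r h x) ->
  g = h.
Proof.
move=> gh; apply: (@is_class_of_inj _ _ _ _ g h (repr g)); first exact: aeW.
by apply: filterS gh => x [? ?]; exact: complex_eqP.
Qed.

Let phi_linear : linear phi.
Proof.
move=> a g h; apply: Linf_eq.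
pose x1 := complex.Re a; pose x2 := complex.Im a.
have k1 := real_Linf_lin (- x2) (bIm g) (bRe h).
have k2 := real_Linf_lin x2 (bRe g) (bIm h).
have eRe : \forall x \ae mu, Phi (Re_r (a *: g + h)) x =
    x1 * Phi (Re_r g) x - x2 * Phi (Im_r g) x + Phi (Re_r h) x.
  have : \forall x \ae mu, Phi (Re_r (a *: g + h)) x = Phi (fun x =>
      x1 * Re_r g x + (- x2 * Im_r g x + Re_r h x)) x.
    apply: Phi_ext => //; first exact: (real_Linf_lin x1 (bRe g) k1).
    apply: filterS2 (reprD (a *: g) h) (reprZ a g) => x.
    by rewrite /Re_r /Im_r => -> ->; rewrite cReD cReM -/x1 -/x2; ring.
  apply: filterS3 (linPhi x1 (bRe g) k1) (linPhi (- x2) (bIm g) (bRe h)).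
  by move=> x -> -> ->; ring.
have eIm : \forall x \ae mu, Phi (Im_r (a *: g + h)) x =
    x1 * Phi (Im_r g) x + x2 * Phi (Re_r g) x + Phi (Im_r h) x.
  have : \forall x \ae mu, Phi (Im_r (a *: g + h)) x = Phi (fun x =>
      x1 * Im_r g x + (x2 * Re_r g x + Im_r h x)) x.
    apply: Phi_ext => //; first exact: (real_Linf_lin x1 (bIm g) k2).
    apply: filterS2 (reprD (a *: g) h) (reprZ a g) => x.
    by rewrite /Re_r /Im_r => -> ->; rewrite cImD cImM -/x1 -/x2; ring.
  apply: filterS3 (linPhi x1 (bIm g) k2) (linPhi x2 (bRe g) (bIm h)).
  by move=> x -> -> ->; ring.
apply: filterS2 (filterI (phiE g) (phiE h)) (filterI (phiE (a *: g + h))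
  (filterI (filterI eRe eIm) (filterI (reprD (a *: phi g) (phi h)) (reprZ a (phi g))))).
move=> x [[g1 g2] [h1 h2]] [[-> ->] [[-> ->] [+ +]]].
rewrite -g1 -g2 -h1 -h2 /Re_r /Im_r => -> ->.
by rewrite cReD cImD cReM cImM -/x1 -/x2; split; ring.
Qed.

HB.instance Definition _ := GRing.isLinear.Build _ _ _ _ phi phi_linear.

Let phi_re_ub (g : W) K : (\forall x \ae mu, Re_r g x <= K) ->
  \forall x \ae mu, Re_r (phi g) x <= K.
Proof.
move=> gK; have b0 := real_Linf_cst mu (0 : R).
have : \forall x \ae mu, - K <= Phi (fun x => -1 * Re_r g x + cst 0 x) x.
  apply: lbPhi; first exact: real_Linf_lin.
  by apply: filterS gK => x /=; lra.
apply: filterS3 (filterI (linPhi (-1) (bRe g) b0) Phi_cst0) (phiE g).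
by move=> x [-> ->] [-> _]; lra.
Qed.

(** Re <w, F v> is the real part of one element G of L^oo, a linear combination of
    the entries of F, so phi preserves its upper bounds. *)
Let norm_form_phi n (F : 'M[W]_n) C (a b c e : 'I_n -> R) :
  (\forall x \ae mu, 0 <= norm_form (\matrix_(i, j) repr (F i j) x) C a b c e) ->
  \forall x \ae mu, 0 <= norm_form (\matrix_(i, j) repr (phi (F i j)) x) C a b c e.
Proof.
have half_le (k z : R) : (0 <= k - 2 * z) = (z <= k / 2).
  by rewrite subr_ge0 mulrC ler_pdivlMr.
pose K := \sum_i C * (a i ^+ 2 + b i ^+ 2 + c i ^+ 2 + e i ^+ 2).
pose coef (p : 'I_n * 'I_n) : R[i] :=
  Complex (c p.1) (- e p.1) * Complex (a p.2) (b p.2).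
pose G := \sum_(p <- index_enum ('I_n * 'I_n)%type) coef p *: F p.1 p.2.
have formE (H : 'I_n -> 'I_n -> R[i]) :
    norm_form (\matrix_(i, j) H i j) C a b c e =
    K - 2 * complex.Re (\sum_(p <- index_enum ('I_n * 'I_n)%type) coef p * H p.1 p.2).
  rewrite -(pair_bigA _ (fun i j => coef (i, j) * H i j))/= cRe_sum.
  rewrite /norm_form sumrB; congr (_ - _); rewrite -mulr_sumr; congr (_ * _).
  apply: eq_bigr => i _; rewrite cRe_sum /re_mul /im_mul !mulr_sumr -big_split/=.
  by apply: eq_bigr => j _; rewrite !mxE !cReM cImM/=; ring.
move=> F0; have : \forall x \ae mu, Re_r G x <= K / 2.
  have rs := repr_sum (index_enum ('I_n * 'I_n)%type) coef (fun p => F p.1 p.2).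
  apply: filterS2 F0 rs.
  by move=> x; rewrite formE /Re_r => + ->; rewrite half_le.
move=> /phi_re_ub.
have -> : phi G = \sum_(p <- index_enum ('I_n * 'I_n)%type) coef p *: phi (F p.1 p.2).
  by rewrite /G linear_sum; apply: eq_bigr => p _; rewrite linearZ.
have rs := repr_sum (index_enum ('I_n * 'I_n)%type) coef (fun p => phi (F p.1 p.2)).
apply: filterS2 rs.
by move=> x; rewrite formE /Re_r => ->; rewrite half_le.
Qed.

Let phi_cc : completely_contractive (@Linf_mxnorm _ _ R mu) phi.
Proof.
move=> n F; apply: ess_sup_le_real => [x|C C0 FC]; first exact: opnorm_ge0.
have F0 : \forall x \ae mu, forall a b c e : 'I_n -> R,
    0 <= norm_form (\matrix_(i, j) repr (F i j) x) C a b c e.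
  by apply: filterS FC => x /(opnorm_norm_form _ C0).
have : \forall x \ae mu, forall p : {ffun 'I_n -> rat} * {ffun 'I_n -> rat} *
    {ffun 'I_n -> rat} * {ffun 'I_n -> rat},
    0 <= norm_form (\matrix_(i, j) repr (phi (F i j)) x) C
      (fun i => ratr (p.1.1.1 i)) (fun i => ratr (p.1.1.2 i))
      (fun i => ratr (p.1.2 i)) (fun i => ratr (p.2 i)).
  apply: ae_forall_countable => p; apply: norm_form_phi.
  by apply: filterS F0 => x; apply.
apply: filterS => x hx; apply/(opnorm_norm_form _ C0).
have -> : (\matrix_(i, j) repr (map_mx phi F i j) x) =
          \matrix_(i, j) repr (phi (F i j)) x.
  by apply/matrixP => i j; rewrite !mxE.
by apply: norm_form_dense => a b c e; exact: (hx (a, b, c, e)).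
Qed.

(** A positive unital real-linear map, applied to real and imaginary parts, is
    completely contractive: for fixed vectors v and w the function Re <w, F v>
    has the same constant upper bounds after applying the map. *)
Lemma complexification : exists2 psi : {linear W -> W},
  completely_contractive (@Linf_mxnorm _ _ R mu) psi &
  forall g, \forall x \ae mu,
    complex.Re (repr (psi g) x) = Phi (fun y => complex.Re (repr g y)) x /\
    complex.Im (repr (psi g) x) = Phi (fun y => complex.Im (repr g y)) x.
Proof. by exists phi; [exact: phi_cc|exact: phiE]. Qed.

End complexification.

(** * Lebesgue measure on the unit interval and its cells *)

Section unit_interval_measure.
Variable R : realType.
Local Notation mu := (lebesgue01 R).
Implicit Types (x y p q : R).

(** Instance search does not see through the conversion between R and the carrier
    of its Borel measurable structure. *)
#[global] Instance ae01_filter : Filter (nbhs (almost_everywhere mu)).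
Proof. exact: (ae_filter_ringOfSetsType mu). Qed.

Lemma lebesgue01E (A : set R) :
  mu A = (@lebesgue_measure R) (A `&` `[0, 1]%classic).
Proof. by []. Qed.

Lemma lebesgue01T : mu setT = 1%E.
Proof. by rewrite lebesgue01E setTI lebesgue_measure_itv/= lte01 oppr0 adde0. Qed.

Lemma lebesgue01_lty : (mu setT < +oo)%E.
Proof. by rewrite lebesgue01T ltry. Qed.

Lemma lebesgue01_gt0 : (0 < mu setT)%E.
Proof. by rewrite lebesgue01T lte01. Qed.

Lemma ae01 : \forall x \ae mu, 0 <= x <= 1.
Proof.
exists (~` `[0, 1]%classic); split.
- by apply: measurableC; exact: measurable_itv.
- suff : (@lebesgue_measure R) (~` `[0, 1]%classic `&` `[0, 1]%classic) = 0%E by [].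
  by rewrite setICl measure0.
- by move=> x /=; rewrite in_itv.
Qed.

Lemma countable_ae01 (A : set R) : countable A -> \forall x \ae mu, ~ A x.
Proof.
move=> cA; have mA : measurable A by exact: countable_measurable.
exists A; split=> //; last by move=> x /= /contrapT.
suff : (@lebesgue_measure R) (A `&` `[0, 1]%classic) = 0%E by [].
apply/eqP; rewrite -measure_le0.
rewrite -(countable_lebesgue_measure0 cA); apply: le_measure; rewrite ?inE//.
by apply: measurableI => //; exact: measurable_itv.
Qed.

Lemma lebesgue01_itv (b c : bool) p q : 0 <= p -> p <= q -> q <= 1 ->
  mu [set` Interval (BSide b p) (BSide c q)] = (q - p)%:E.
Proof.
move=> p0 pq q1; rewrite lebesgue01E setIidl; last first.
  by apply: subset_itv; [case: b|case: c]; rewrite bnd_simp.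
rewrite lebesgue_measure_itv/= lte_fin; case: ltP => // qp.
by rewrite (_ : q = p) ?subrr//; apply/eqP; rewrite eq_le qp.
Qed.

Lemma ae01_ball x (d : R) (P : R -> Prop) : 0 <= x <= 1 -> 0 < d ->
  (\forall y \ae mu, P y) -> exists y, [/\ 0 <= y <= 1, `|y - x| < d & P y].
Proof.
move=> /andP[x0 x1] d0 [N [mN N0 PN]].
pose p := Num.max 0 (x - d); pose q := Num.min 1 (x + d).
have pq : p < q.
  by rewrite /p /q gt_max !lt_min; do 2 (apply/andP; split); lra.
have : `]p, q[%classic `\` N !=set0.
  apply/set0P/negP => /eqP pN.
  have : (mu `]p, q[%classic <= mu N)%E.
    apply: le_measure; rewrite ?inE//.
    by rewrite -setD_eq0.
  rewrite N0 lebesgue01_itv ?(ltW pq)//.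
  - by rewrite lee_fin subr_le0 leNgt pq.
  - by rewrite /p le_max lexx.
  - by rewrite /q ge_min lexx.
move=> [y [/=]]; rewrite in_itv/= => /andP[].
rewrite /p /q gt_max lt_min => /andP[y0 xy] /andP[y1 yx] Ny; exists y; split.
- by rewrite !ltW.
- by rewrite ltr_norml; apply/andP; split; lra.
- by apply: contrapT => nP; apply: Ny; exact: PN.
Qed.

Definition cell (n : nat) x : int := Num.floor (x * n.+1%:R).

Lemma cellE n i : cell n @^-1` [set i] =
  `[i%:~R / n.+1%:R, (i + 1)%:~R / n.+1%:R[%classic.
Proof.
apply/seteqP; split=> x /=; rewrite in_itv/= ler_pdivrMr// ltr_pdivlMr//.
  by move=> <-; rewrite /cell floor_le_tmp lt_succ_floor.
by move=> h; apply/floor_def.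
Qed.

Lemma measurable_cell n i : measurable (cell n @^-1` [set i] : set R).
Proof. by rewrite cellE; exact: measurable_itv. Qed.

Lemma cell_dist n x y : cell n y = cell n x -> `|y - x| < n.+1%:R^-1.
Proof.
have h z : (cell n z)%:~R / n.+1%:R <= z < (cell n z)%:~R / n.+1%:R + n.+1%:R^-1.
  have : (cell n @^-1` [set cell n z]) z by [].
  by rewrite cellE /= in_itv/= intrD mulrDl mul1r.
have /andP[x1 x2] := h x; have /andP[y1 y2] := h y.
move=> yx; move: y1 y2 x1 x2; rewrite yx.
move: ((cell n x)%:~R / n.+1%:R : R) (n.+1%:R^-1 : R) => a e y1 y2 x1 x2.
by rewrite ltr_norml; apply/andP; split; lra.
Qed.

(** Only the countably many end points of cells have to be avoided. *)
Lemma ae_cell_nbhs : \forall x \ae mu, forall n, exists2 d : R, 0 < d &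
  forall y, `|y - x| < d -> cell n y = cell n x.
Proof.
have : \forall x \ae mu, ~ (range (fun p : int * nat => p.1%:~R / p.2.+1%:R : R)) x.
  by apply: countable_ae01; apply: sub_countable (card_image_le _ _) _; exact: countableP.
apply: filterS => x xN n.
pose a : R := (cell n x)%:~R / n.+1%:R; pose b : R := (cell n x + 1)%:~R / n.+1%:R.
have : (cell n @^-1` [set cell n x]) x by [].
rewrite cellE /= in_itv/= -/a -/b => /andP[ax xb].
have {}ax : a < x.
  rewrite lt_neqAle ax andbT; apply/eqP => ax0; apply: xN.
  by exists (cell n x, n).
exists (Num.min (x - a) (b - x)); first by rewrite lt_min !subr_gt0 ax.
move=> y; rewrite lt_min ltr_norml (ltr_norml _ (b - x)) => /andP[/andP[h1 h2] /andP[h3 h4]].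
suff : (cell n @^-1` [set cell n x]) y by [].
rewrite cellE /= in_itv/= -/a -/b; clearbody a b.
by apply/andP; split; lra.
Qed.

End unit_interval_measure.

(** * Fixed elements are essentially continuous almost everywhere *)

Section continuous_functions.
Variable R : realType.

Lemma within01_continuousP (f : R -> (R[i])^o) :
  {within `[0, 1], continuous f} <-> forall x (e : R), 0 <= x <= 1 -> 0 < e ->
    exists2 d : R, 0 < d & forall y, 0 <= y <= 1 -> `|y - x| < d ->
      cmod (f y - f x) < e.
Proof.
have in01 x : `[0, 1]%classic x <-> 0 <= x <= 1 by rewrite /= in_itv.
split=> [/subspace_continuousP cf x e /in01 x01 e0|h].
  have /cvgrPdist_lt /(_ e%:C) := cf x x01.
  rewrite ltcR => /(_ e0) [d /= d0 hd].
  exists d => // y /in01 y01 yx; rewrite -ltcR cmodE distrC; apply: hd => //=.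
  by rewrite distrC.
apply/subspace_continuousP => x /in01 x01; apply/cvgrPdist_lt => e e0.
have er : complex.Im e = 0 by move: e0; rewrite ltcE/= => /andP[/eqP].
have {}er : e = (complex.Re e)%:C by case: e er {e0} => a b /= ->.
rewrite er in e0 *; rewrite ltcR in e0.
have [d d0 hd] := h x _ x01 e0; exists d => //= y /= xy /in01 y01.
by rewrite distrC -cmodE ltcR hd// distrC.
Qed.

(** Heine-Cantor, from the near-covering form of compactness. *)
Lemma uniform_continuous01 (f : R -> (R[i])^o) (e : R) :
  {within `[0, 1], continuous f} -> 0 < e ->
  exists2 d : R, 0 < d & forall x y, 0 <= x <= 1 -> 0 <= y <= 1 ->
    `|y - x| < d -> cmod (f y - f x) < e.
Proof.
move=> /within01_continuousP cf e0.
have := @segment_compact R 0 1; rewrite compact_near_coveringP.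
move=> /(_ R (0^'+) (fun d x => 0 <= x <= 1 -> forall y, 0 <= y <= 1 ->
  `|y - x| < d -> cmod (f y - f x) < e) _)[].
  move=> x; rewrite /= in_itv/= => x01.
  have e20 : 0 < e / 2 by rewrite divr_gt0.
  have [d d0 hd] := cf x (e / 2) x01 e20.
  have d20 : 0 < d / 2 by rewrite divr_gt0.
  exists (ball x (d / 2), [set r | r < d / 2]) => /=.
    split; first exact: nbhsx_ballx.
    by exists (d / 2) => //= r /=; rewrite sub0r normrN => /(le_lt_trans (ler_norm _)).
  move=> [z r] /= [xz rd] z01 y y01 yz.
  have zx : `|z - x| < d / 2 by rewrite distrC.
  have yx : `|y - x| < d.
    rewrite (_ : y - x = (y - z) + (z - x)); last by ring.
    rewrite (le_lt_trans (ler_normD _ _))// (splitr d) ltrD//.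
    exact: lt_trans yz rd.
  rewrite (_ : f y - f z = (f y - f x) + (f x - f z)); last by rewrite addrA subrK.
  rewrite (le_lt_trans (cmodD _ _))// (splitr e) ltrD ?hd//.
  rewrite -ltcR cmodE distrC -cmodE ltcR hd//.
  by rewrite (lt_trans zx)// [ltRHS]splitr ltrDl.
move=> d /= d0 hd; exists (d / 2); first by rewrite divr_gt0.
move=> x y x01 y01 yx; apply: (hd (d / 2)) => //=.
- by rewrite sub0r normrN gtr0_norm ?divr_gt0// ltr_pdivrMr// ltr_pMr// ltr1n.
- by rewrite divr_gt0.
Qed.

End continuous_functions.

Section fixed_elements.
Variable R : realType.
Local Notation mu := (lebesgue01 R).
Local Notation W := (Linf mu).
Local Notation fixed := (fixed_set (@Linf_mxnorm _ _ R mu) (@C01 R)).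
Implicit Types g : W.

Lemma C01_cell_osc g (e : R) : C01 g -> 0 < e -> exists N, forall n, (N <= n)%N ->
  \forall x \ae mu, \forall y \ae mu, cell n y = cell n x ->
    cmod (repr g y - repr g x) <= e.
Proof.
move=> [f cf fg] e0; have [d d0 hd] := uniform_continuous01 cf e0.
have [N _ hN] := near_infty_natSinv_lt (PosNum d0).
exists N => n /hN nd; apply: filterS2 (fg) (ae01 R) => x fx x01.
apply: filterS2 fg (ae01 R) => y fy y01 /cell_dist xy.
rewrite -fx -fy; apply/ltW/hd => //; exact: lt_trans xy nd.
Qed.

(** The extremal operator built from Re g itself, extended to complex functions,
    has to fix g. *)
Lemma fixed_upper g : fixed g -> \forall x \ae mu, forall e : R, 0 < e ->
  exists2 d : R, 0 < d & \forall y \ae mu, `|y - x| < d ->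
    complex.Re (repr g y) <= complex.Re (repr g x) + e.
Proof.
move=> fix_g; have [bRe _] := repr_real_Linf g.
have [Phi [[bmPhi linPhi lbPhi] fixPhi extPhi]] :=
  extremal_limit_operator (lebesgue01_lty R) (lebesgue01_gt0 R)
    (@measurable_cell R) bRe.
have [phi phi_cc phiE] := complexification bmPhi linPhi lbPhi.
have phi_g : phi g = g.
  apply: fix_g => // v Cv; have [bRv bIv] := repr_real_Linf v.
  have fR : \forall x \ae mu, Phi (fun y => complex.Re (repr v y)) x = complex.Re (repr v x).
    apply: fixPhi => // e e0; have [N hN] := C01_cell_osc Cv e0.
    exists N => n /hN; apply: filterS => x; apply: filterS => y + xy => /(_ xy).
    apply: le_trans; apply: le_trans (Re_le_cmod _).
    by rewrite cReD; case: (repr v x) => a b /=.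
  have fI : \forall x \ae mu, Phi (fun y => complex.Im (repr v y)) x = complex.Im (repr v x).
    apply: fixPhi => // e e0; have [N hN] := C01_cell_osc Cv e0.
    exists N => n /hN; apply: filterS => x; apply: filterS => y + xy => /(_ xy).
    apply: le_trans; apply: le_trans (Im_le_cmod _).
    by rewrite cImD; case: (repr v x) => a b /=.
  apply: (@is_class_of_inj _ _ _ _ _ _ (repr (phi v))); first exact: aeW.
  apply: filterS3 fR fI (phiE v) => x xR xI [pR pI].
  by apply: complex_eqP; [rewrite pR xR|rewrite pI xI].
have : \forall x \ae mu, Phi (fun y => complex.Re (repr g y)) x = complex.Re (repr g x).
  by have := phiE g; rewrite phi_g; apply: filterS => x [-> _].
move=> /extPhi; apply: filterS2 (ae_cell_nbhs R) => x nb h e /h[n hn].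
have [d d0 hd] := nb n; exists d => //.
by apply: filterS hn => y + /hd; apply.
Qed.

Lemma fixedZ a g : fixed g -> fixed (a *: g).
Proof.
by move=> fix_g phi phi_cc phi_C; rewrite linearZ/= fix_g.
Qed.

Definition ess_continuous_at (k : R -> R) (x : R) := forall e : R, 0 < e ->
  exists2 d : R, 0 < d & \forall y \ae mu, `|y - x| < d -> `|k y - k x| <= e.

Lemma fixed_Re_ess_continuous g : fixed g ->
  \forall x \ae mu, ess_continuous_at (fun y => complex.Re (repr g y)) x.
Proof.
move=> fix_g; have up := fixed_upper fix_g.
have lo := fixed_upper (fixedZ (-1) fix_g).
have N1 := reprZ (-1) g.
apply: filterS3 up lo (N1) => x up lo Nx e e0.
have [d d0 hd] := up e e0; have [d' d'0 hd'] := lo e e0.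
exists (Num.min d d'); first by rewrite lt_min d0.
apply: filterS3 hd hd' N1 => y h h' Ny; rewrite lt_min => /andP[/h {}h /h'].
by rewrite Nx Ny !mulN1r !raddfN/= ler_norml => h1; apply/andP; split; lra.
Qed.

Lemma fixed_ess_continuous g : fixed g ->
  \forall x \ae mu, ess_continuous_at (fun y => complex.Re (repr g y)) x /\
                     ess_continuous_at (fun y => complex.Im (repr g y)) x.
Proof.
move=> fix_g; have ec := fixed_Re_ess_continuous (fixedZ (- 'i) fix_g).
have Ei : \forall x \ae mu, complex.Re (repr (- 'i *: g) x) = complex.Im (repr g x).
  by apply: filterS (reprZ (- 'i) g) => x ->; rewrite cReM/=; lra.
apply: filterS3 (fixed_Re_ess_continuous fix_g) ec (Ei) => x Rx Ix ix; split=> //.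
move=> e /Ix [d d0 hd]; exists d => //.
by apply: filterS2 hd Ei => y + iy; rewrite iy ix.
Qed.

End fixed_elements.

(** * Riemann sums as integrals of step functions *)

Section step_functions.
Variable R : realType.
Local Notation mu := (lebesgue01 R).
Implicit Types (f : R -> R) (a x : R) (s t : seq R).

(** Step function with value f t`_i on the i-th interval of the partition a :: s.
    Only the right end points are tested: the value to the left of a is
    irrelevant, and this makes the recursion on s immediate. *)
Fixpoint step f a s t x : R :=
  match s, t with
  | b :: s', c :: t' => if x < b then f c else step f b s' t' x
  | _, _ => 0
  end.

Definition real_riemann_sum f a s t : R :=
  \sum_(i < size s) f t`_i * (s`_i - (a :: s)`_i).

Definition real_riemann_integrable f := exists I : R, forall eps : R, 0 < eps ->
  exists2 delta : R, 0 < delta & forall s t, tagged_partition 0 1 s t ->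
    mesh_lt 0 s delta -> `|real_riemann_sum f 0 s t - I| < eps.

Lemma measurable_step f a s t : measurable_fun setT (step f a s t).
Proof.
elim: s a t => [|b s IH] a [|c t] //=.
by apply: measurable_fun_ifT => //=; exact: measurable_fun_ltr.
Qed.

Lemma step_at f a s t x : size t = size s -> path <%R a s ->
  a <= x < last a s -> exists i, [/\ (i < size s)%N, step f a s t x = f t`_i &
    (a :: s)`_i <= x < s`_i].
Proof.
elim: s a t => [|b s IH] a [|c t] //=;
  first by move=> _ _ /andP[/le_lt_trans h /h]; rewrite ltxx.
move=> [st] /andP[ab bs] /andP[ax xl].
case: ltP => xb; first by exists 0%N; rewrite /= ax xb.
have [|i [si -> h]] := IH b t st bs; first by rewrite xb xl.
by exists i.+1.
Qed.

Lemma path_lt_last a s : path <%R a s -> a <= last a s.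
Proof.
elim: s a => [//|b s IH] a /= /andP[ab /IH]; apply: le_trans; exact: ltW.
Qed.

Lemma step_integrable f a s t (p q : R) :
  mu.-integrable `[p, q[%classic (EFin \o step f a s t).
Proof.
apply: measurable_bounded_integrable.
- exact: measurable_itv.
- apply: le_lt_trans (lebesgue01_lty R).
  by apply: le_measure; rewrite ?inE//; exact: measurable_itv.
- apply: measurable_funTS; exact: measurable_step.
elim: s a t => [|b s IH] a [|c t] /=;
  try by exists 0; split => // z z0 x _; rewrite normr0 ltW.
have [M [_ hM]] := IH b t; exists (Num.max `|f c| M); split; first by rewrite num_real.
move=> z.
rewrite gt_max => /andP[cz Mz] x xpq /=; case: ifPn => _; [exact: ltW|exact: hM].
Qed.

Lemma Rintegral_step f a s t : size t = size s -> path <%R a s ->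
  0 <= a -> last a s <= 1 ->
  \int[mu]_(x in `[a, last a s[) step f a s t x = real_riemann_sum f a s t.
Proof.
elim: s a t => [|b s IH] a [|c t] //=.
  by move=> *; rewrite set_itvco0 Rintegral_set0 /real_riemann_sum big_ord0.
move=> [st] /andP[ab bs] a0 l1.
have bl := path_lt_last bs.
rewrite /real_riemann_sum big_ord_recl/=.
have -> : \sum_(i < size s) f (c :: t)`_(lift ord0 i) *
    ((b :: s)`_(lift ord0 i) - (a :: b :: s)`_(lift ord0 i)) =
    real_riemann_sum f b s t by [].
rewrite -IH//; last exact: le_trans a0 (ltW ab).
rewrite (_ : `[a, last b s[%classic =
    `[a, b[%classic `|` `[b, last b s[%classic); last first.
  by rewrite -itv_bndbnd_setU// ?bnd_simp// ltW.
rewrite Rintegral_setU.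
- congr (_ + _).
    transitivity (\int[mu]_(x in `[a, b[) (cst (f c) x)).
      by apply: eq_Rintegral => x; rewrite inE/= in_itv/= => /andP[_ ->].
    by rewrite Rintegral_cst// lebesgue01_itv// ?(ltW ab) ?(le_trans bl l1).
  apply: eq_Rintegral => x; rewrite inE/= in_itv/= => /andP[bx _].
  by rewrite ltNge bx.
- exact: measurable_itv.
- exact: measurable_itv.
- rewrite -itv_bndbnd_setU// ?bnd_simp ?(ltW ab)//.
  exact: (@step_integrable f a (b :: s) (c :: t)).
- apply/disj_set2P; rewrite -subset0 => x [] /=; rewrite !in_itv/=.
  by move=> /andP[_ /lt_le_trans xb] /andP[/xb]; rewrite ltxx.
Qed.

End step_functions.

(** * Riemann integrability from almost everywhere continuity *)

Section riemann_from_ae_continuity.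
Variable R : realType.
Local Notation mu := (lebesgue01 R).
Implicit Types (f k : R -> R) (s t : seq R).

(** If the sums did not converge to the integral of k, some partitions with mesh
    below 1 / (n + 1) would have sums bounded away from it; but the associated
    step functions converge to k almost everywhere and are bounded by M.  As f
    may be non-measurable, its integral is that of k. *)
Lemma ae_continuous_riemann f k (M : R) : real_Linf mu k ->
  (forall x, 0 <= x <= 1 -> `|f x| <= M) ->
  (\forall x \ae mu, forall e : R, 0 < e -> exists2 d : R, 0 < d &
     forall u, 0 <= u <= 1 -> `|u - x| < d -> `|f u - k x| <= e) ->
  real_riemann_integrable f.
Proof.
move=> bk fM fk; exists (\int[mu]_(x in `[0, 1[) k x) => eps eps0.
apply: contrapT => nd.
have H n : exists st : seq R * seq R, [/\ tagged_partition 0 1 st.1 st.2,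
    mesh_lt 0 st.1 n.+1%:R^-1 &
    eps <= `|real_riemann_sum f 0 st.1 st.2 - \int[mu]_(x in `[0, 1[) k x|].
  apply: contrapT => nst; apply: nd; exists n.+1%:R^-1; first by rewrite invr_gt0.
  move=> s t tst mst; rewrite ltNge; apply/negP => h; apply: nst.
  by exists (s, t).
have [st stP] := choice H.
pose h n := step f 0 (st n).1 (st n).2.
have mD : measurable (`[0, 1[%classic : set (measurableTypeR R)) by exact: measurable_itv.
have tag01 n x : 0 <= x < 1 -> exists u, [/\ 0 <= u <= 1, h n x = f u &
    `|u - x| < n.+1%:R^-1].
  move=> x01; have [[[p01 /eqP l1] sz tg] ms _] := stP n.
  have [|i [si hi ix]] := @step_at _ f 0 (st n).1 (st n).2 x sz p01.
    by rewrite l1.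
  have abs : itv_partition 0 1 (st n).1 by split=> //; apply/eqP.
  have tgi := tg i si; have msi := ms i si.
  exists (st n).2`_i; split=> //.
    have i0 : 0 <= (0 :: (st n).1)`_i.
      by have := itv_partition_nth_ge (ltnW si) abs; rewrite (set_nth_default 0)//= ltnW.
    have i1 : (st n).1`_i <= 1.
      by have := itv_partition_nth_le (m := i.+1) si abs; rewrite (set_nth_default 0).
    by move/andP : tgi => [ai bi]; rewrite (le_trans i0 ai) (le_trans bi i1).
  move: tgi ix msi; move: (_`_i) ((st n).1`_i) ((st n).2`_i) (n.+1%:R^-1 : R).
  move=> p q r e' /andP[? ?] /andP[? ?] ?.
  by rewrite ltr_norml; apply/andP; split; lra.
have intk : mu.-integrable `[0, 1[%classic (EFin \o k).
  by apply: real_Linf_integrable => //; exact: lebesgue01_lty.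
have [|||||_ _] := @dominated_convergence _ _ _ mu `[0, 1[%classic mD
  (fun n => EFin \o h n) (EFin \o k) (cst M%:E).
- by move=> n; apply/measurable_EFinP/measurable_funTS; exact: measurable_step.
- by apply: (@measurable_int _ _ _ mu).
- apply: filterS fk => x fkx; rewrite /= in_itv/= => x01.
  apply: cvg_EFin; first exact: nearW.
  apply/cvgrPdist_le => e e0; have [d d0 hd] := fkx e e0.
  have [N _ hN] := near_infty_natSinv_lt (PosNum d0).
  exists N => // n Nn /=; have [u [u01 -> ux]] := tag01 n x x01.
  by rewrite distrC; apply: hd => //; exact: lt_trans ux (hN n Nn).
- exact: (real_Linf_integrable (lebesgue01_lty R) (real_Linf_cst mu M) mD).
- apply: aeW => x n; rewrite /= in_itv/= lee_fin => x01.
  by have [u [u01 -> _]] := tag01 n x x01; exact: fM.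
move=> cv.
have rsE n : \int[mu]_(x in `[0, 1[) h n x = real_riemann_sum f 0 (st n).1 (st n).2.
  have [[[p01 /eqP l1] sz _] _ _] := stP n.
  have := @Rintegral_step _ f 0 (st n).1 (st n).2 sz p01 (lexx 0).
  by rewrite l1; apply.
have {}cv : \int[mu]_(x in `[0, 1[) h n x @[n --> \oo] --> \int[mu]_(x in `[0, 1[) k x.
  by apply: fine_cvg; rewrite EFin_Rintegral.
move/cvgrPdist_lt : cv => /(_ eps eps0)[N _ /(_ N (leqnn N))] /=.
have [_ _ + ] := stP N; rewrite rsE distrC => h1 /(le_lt_trans h1).
by rewrite ltxx.
Qed.

End riemann_from_ae_continuity.

Section fixed_implies_riemann.
Variable R : realType.
Local Notation mu := (lebesgue01 R).
Implicit Types (k : R -> R) (x u c : R).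

Definition local_ub k x : set R := [set c | exists2 d : R, 0 < d &
  \forall y \ae mu, `|y - x| < d -> k y <= c].

(** The limit of the essential suprema of k over shrinking balls around x.  It
    depends only on the class of k and yet has a value at each point, which makes
    it a candidate for a Riemann integrable representative. *)
Definition usc_envelope k x : R := inf (local_ub k x).

Lemma usc_envelope_bounds k x (l c : R) : 0 <= x <= 1 ->
  (exists2 d : R, 0 < d & \forall y \ae mu, `|y - x| < d -> l <= k y <= c) ->
  l <= usc_envelope k x <= c.
Proof.
move=> x01 [d d0 lkc].
have Sc : local_ub k x c by exists d => //; apply: filterS lkc => y + yx => /(_ yx)/andP[].
have lS : lbound (local_ub k x) l.
  move=> c' [d' d'0 kc'].
  have md0 : 0 < Num.min d d' by rewrite lt_min d0.
  have [y [_]] := ae01_ball x01 md0 (filterI lkc kc').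
  rewrite lt_min => /andP[yd yd'] [/(_ yd)/andP[ly _] /(_ yd')].
  exact: le_trans.
apply/andP; split; last by apply: ge_inf => //; exists l.
by apply: lb_le_inf => //; exists c.
Qed.

(** Where k is essentially continuous, the envelope agrees with k and is continuous
    there, as it inherits local essential bounds of k at every point. *)
Lemma ess_continuous_riemann k : real_Linf mu k ->
  (\forall x \ae mu, ess_continuous_at k x) ->
  exists2 f : R -> R, \forall x \ae mu, f x = k x &
  real_riemann_integrable f.
Proof.
move=> bk ec; have [_ [M kM]] := bk.
have near_k : \forall x \ae mu, forall e : R, 0 < e -> exists2 d : R, 0 < d &
     forall u, 0 <= u <= 1 -> `|u - x| < d -> `|usc_envelope k u - k x| <= e.
  apply: filterS ec => x ecx e /ecx[d d0 kd]; exists d => // u u01 ux.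
  rewrite ler_distl; apply: usc_envelope_bounds => //.
  exists (d - `|u - x|); first by rewrite subr_gt0.
  apply: filterS kd => y + yu; rewrite ler_distl; apply.
  rewrite (_ : y - x = (y - u) + (u - x)); last by ring.
  by rewrite (le_lt_trans (ler_normD _ _))// -ltrBrDr.
exists (usc_envelope k).
  apply: filterS2 near_k (ae01 R) => x nx x01; apply/eqP.
  rewrite -subr_eq0 -normr_le0; apply/ler_addgt0Pr => e e0; rewrite add0r.
  by have [d d0] := nx e e0; apply; rewrite // subrr normr0.
apply: (@ae_continuous_riemann _ _ k M bk _ near_k) => x x01.
rewrite ler_norml; apply: usc_envelope_bounds => //; exists 1 => //.
by apply: filterS kM => y + _; rewrite ler_norml.
Qed.

Lemma riemann_sumE (f : R -> R[i]) s t : size t = size s ->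
  complex.Re (riemann_sum 0 f s t) =
    real_riemann_sum (fun x => complex.Re (f x)) 0 s t /\
  complex.Im (riemann_sum 0 f s t) =
    real_riemann_sum (fun x => complex.Im (f x)) 0 s t.
Proof.
move=> st; rewrite /riemann_sum cRe_sum cIm_sum; split; apply: eq_bigr => i _.
  by rewrite cReM/= mulr0 subr0.
by rewrite cImM/= mulr0 add0r.
Qed.

Lemma riemann_integrable_ReIm (f g : R -> R) :
  real_riemann_integrable f ->
  real_riemann_integrable g ->
  riemann_integrable 0 1 (fun x => f x +i* g x).
Proof.
move=> [I fI] [J gJ]; exists (I +i* J) => eps eps0.
have e20 : 0 < eps / 2 by rewrite divr_gt0.
have [d d0 hd] := fI _ e20; have [d' d'0 hd'] := gJ _ e20.
exists (Num.min d d'); first by rewrite lt_min d0.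
move=> s t tst mst.
have md : mesh_lt 0 s d by move=> i /mst; rewrite lt_min => /andP[].
have md' : mesh_lt 0 s d' by move=> i /mst; rewrite lt_min => /andP[].
have [_ st _] := tst.
have [re im] := riemann_sumE (fun x => f x +i* g x) st.
rewrite (le_lt_trans (cmod_le_ReIm _))// (splitr eps).
rewrite cReD cImD re im; apply: ltrD; [exact: hd|exact: hd'].
Qed.

Lemma fixed_riemann (g : Linf mu) :
  fixed_set (@Linf_mxnorm _ _ R mu) (@C01 R) g ->
  exists2 f : R -> R[i], riemann_integrable 0 1 f & is_class_of mu g f.
Proof.
move=> fix_g; have [bR bI] := repr_real_Linf g.
have ec := fixed_ess_continuous fix_g.
have [|f1 f1E rf1] := ess_continuous_riemann bR.
  by apply: filterS ec => x [].
have [|f2 f2E rf2] := ess_continuous_riemann bI.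
  by apply: filterS ec => x [].
exists (fun x => f1 x +i* f2 x); first exact: riemann_integrable_ReIm.
by apply: filterS2 f1E f2E => x h1 h2; apply: complex_eqP.
Qed.

End fixed_implies_riemann.

(** * Contractions fixing continuous functions preserve local bounds *)

Section one_by_one.
Variable R : realType.

Lemma l2norm1 (v : 'cV[R[i]]_1) : l2norm v = cmod (v 0 0).
Proof. by rewrite /l2norm big_ord1 sqrtr_sqr ger0_norm ?cmod_ge0. Qed.

Lemma opnorm1 (A : 'M[R[i]]_1) : opnorm A = cmod (A 0 0).
Proof.
have Av (v : 'cV[R[i]]_1) : l2norm (A *m v) = cmod (A 0 0) * cmod (v 0 0).
  by rewrite l2norm1 mxE big_ord1 cmodM.
have one1 : cmod (1 : R[i]) = 1 by apply: (@complexI R); rewrite cmodE normr1.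
apply/eqP; rewrite eq_le; apply/andP; split.
  apply: sup_le_ub.
    by exists (l2norm (A *m const_mx 0)), (const_mx 0); rewrite //= l2norm1 mxE cmod0.
  by move=> _ [v /= v1 <-]; rewrite Av ler_piMr ?cmod_ge0// -l2norm1.
have := opnorm_bound A (const_mx 1).
by rewrite Av l2norm1 !mxE one1 !mulr1.
Qed.

End one_by_one.

Section contraction.
Context d (T : measurableType d) (R : realType).
Variable mu : {measure set T -> \bar R}.
Local Notation W := (Linf mu).

Lemma cc_contractive (phi : W -> W) (g : W) (C : R) :
  completely_contractive (@Linf_mxnorm _ _ R mu) phi ->
  (\forall x \ae mu, cmod (repr g x) <= C) ->
  \forall x \ae mu, cmod (repr (phi g) x) <= C.
Proof.
move=> cc gC.
have E (h : W) x :
    opnorm (\matrix_(i, j) repr ((const_mx h : 'M[W]_1) i j) x) =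
    cmod (repr h x) by rewrite opnorm1 !mxE.
have : (Linf_mxnorm mu (const_mx (phi g) : 'M[W]_1) <= C%:E)%E.
  rewrite -map_const_mx; apply: le_trans (cc 1%N (const_mx g)) _.
  apply/ess_supP; apply: filterS gC => x.
  by rewrite -(E g) -lee_fin.
move=> /ess_supP; apply: filterS => x.
by rewrite lee_fin (E (phi g)).
Qed.

End contraction.

Section positivity.
Variable R : realType.
Local Notation mu := (lebesgue01 R).
Local Notation W := (Linf mu).
Variable phi : {linear W -> W}.
Hypothesis phi_cc : completely_contractive (@Linf_mxnorm _ _ R mu) phi.
Hypothesis phi_C : forall v, C01 v -> phi v = v.

Lemma C01_lipschitz (k : R -> R) (L : R) : real_Linf mu k -> 0 <= L ->
  (forall x y, `|k x - k y| <= L * `|x - y|) ->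
  {v : W | C01 v & is_class_of mu v (fun x => (k x)%:C)}.
Proof.
move=> bk L0 kL; have [v vk] := Linf_of_real_Linf bk (real_Linf_cst mu 0).
exists v => //; exists (fun x => (k x)%:C) => //.
apply/within01_continuousP => x e x01 e0; exists (e / (L + 1)).
  by rewrite divr_gt0// ltr_wpDl.
move=> y y01 yx; rewrite -rmorphB -ltcR cmodE.
rewrite normc_def/= expr0n addr0 sqrtr_sqr ltcR.
rewrite (le_lt_trans (kL _ _))// (le_lt_trans (y := (L + 1) * `|y - x|))//.
  by rewrite ler_wpM2r// lerDl.
by rewrite mulrC -ltr_pdivlMr// ltr_wpDl.
Qed.

(** If 0 <= Re h and |h| <= M then |h - n|^2 <= M^2 + n^2 for every n, hence
    |phi h - n|^2 <= M^2 + n^2, that is - 2 n Re (phi h) <= M^2; let n grow. *)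
Lemma phi_Re_ge0 (h : W) : (\forall x \ae mu, 0 <= complex.Re (repr h x)) ->
  \forall x \ae mu, 0 <= complex.Re (repr (phi h) x).
Proof.
move=> h0; have /asboolP[_ [M hM]] := Linf_valP (repr h).
have [|one C1 one1] := @C01_lipschitz (cst 1) 0 (real_Linf_cst mu 1) (lexx 0).
  by move=> x y; rewrite subrr normr0 mul0r.
have H n : \forall x \ae mu, - (2 * n%:R * complex.Re (repr (phi h) x)) <= M ^+ 2.
  pose t : R[i] := (- n%:R : R)%:C.
  have hn : \forall x \ae mu, cmod (repr (h + t *: one) x) <= Num.sqrt (M ^+ 2 + n%:R ^+ 2).
    apply: filterS3 (filterI h0 hM) (filterI (reprD h (t *: one)) (reprZ t one)) one1.
    move=> x [h0x hMx] [-> ->] <-.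
    rewrite -(ger0_norm (cmod_ge0 _)) -sqrtr_sqr ler_wsqrtr// cmod_sqr.
    have : cmod (repr h x) ^+ 2 <= M ^+ 2.
      by rewrite ler_pXn2r ?nnegrE ?cmod_ge0// (le_trans (cmod_ge0 _) hMx).
    rewrite cmod_sqr cReD cImD cReM cImM /t/=.
    have := mulr_ge0 (ler0n R n) h0x.
    move: (n%:R : R) (complex.Re _) (complex.Im _) => N a b Na ab.
    rewrite [leLHS](_ : _ = a ^+ 2 + b ^+ 2 - 2 * (N * a) + N ^+ 2); last by ring.
    by rewrite lerD2r; lra.
  have := cc_contractive phi_cc hn.
  rewrite linearD linearZ/= (phi_C C1).
  apply: filterS3 (filterI (reprD (phi h) (t *: one)) (reprZ t one)) one1.
  move=> x [-> ->] <-; rewrite -(ger0_norm (cmod_ge0 _)) -sqrtr_sqr.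
  rewrite ler_sqrt ?addr_ge0 ?sqr_ge0// cmod_sqr cReD cImD cReM cImM /t/=.
  move: (n%:R : R) (complex.Re _) (complex.Im _) => N a b.
  rewrite [leLHS](_ : _ = a ^+ 2 + b ^+ 2 - 2 * N * a + N ^+ 2); last by ring.
  by rewrite lerD2r => ab; have := sqr_ge0 a; have := sqr_ge0 b; lra.
have /ae_foralln := H; apply: filterS => x Hx.
rewrite leNgt; apply/negP => r0.
set r := complex.Re _ in r0 Hx; pose n := (Num.truncn (M ^+ 2 / - r)).+1.
have : M ^+ 2 / - r < n%:R by exact: truncnS_gt.
rewrite ltr_pdivrMr ?oppr_gt0// => Mn; have := Hx n.
have := mulr_ge0 (ler0n R n) (ltW (_ : 0 < - r)).
rewrite oppr_gt0 => /(_ r0); move: Mn; rewrite -/r; move: (n%:R : R) => N; nra.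
Qed.

Lemma phi_Re_ge (h v : W) : C01 v ->
  (\forall x \ae mu, complex.Re (repr v x) <= complex.Re (repr h x)) ->
  \forall x \ae mu, complex.Re (repr v x) <= complex.Re (repr (phi h) x).
Proof.
move=> Cv vh; have : \forall x \ae mu, 0 <= complex.Re (repr (phi (h + -1 *: v)) x).
  apply: phi_Re_ge0; apply: filterS3 vh (reprD h (-1 *: v)) (reprZ (-1) v).
  by move=> x vhx -> ->; rewrite cReD cReM/=; lra.
rewrite linearD linearZ/= (phi_C Cv).
apply: filterS3 (reprD (phi h) (-1 *: v)) (reprZ (-1) v).
by move=> x -> ->; rewrite cReD cReM/=; lra.
Qed.

End positivity.

Section local_bounds.
Variable R : realType.
Local Notation mu := (lebesgue01 R).
Local Notation W := (Linf mu).
Variable phi : {linear W -> W}.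
Hypothesis phi_cc : completely_contractive (@Linf_mxnorm _ _ R mu) phi.
Hypothesis phi_C : forall v, C01 v -> phi v = v.
Implicit Types (h : W) (p q c x y : R).

(** Equal to c on ]p + 1/n, q - 1/n[ and at most c - K outside ]p, q[. *)
Definition tent p q c K (n : nat) x : R :=
  c - K * Num.max 0 (1 - n%:R * Num.min (x - p) (q - x)).

Lemma dist_max0 x y : `|Num.max 0 x - Num.max 0 y| <= `|x - y|.
Proof.
have h (u v : R) : Num.max 0 u - Num.max 0 v <= `|u - v|.
  rewrite lerBlDr ge_max addr_ge0 ?le_max ?lexx//=.
  by rewrite -{1}(subrK v u) lerD ?ler_norm// le_max lexx orbT.
by rewrite ler_norml lerNl opprB {1}distrC !h.
Qed.

Lemma dist_min p q x y :
  `|Num.min (x - p) (q - x) - Num.min (y - p) (q - y)| <= `|x - y|.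
Proof.
have h (u v : R) : Num.min (u - p) (q - u) - Num.min (v - p) (q - v) <= `|u - v|.
  rewrite lerBlDr -lerBlDl le_min !lerBlDl; apply/andP; split; rewrite ge_min.
    by have := ler_norm (u - v) => ?; apply/orP; left; lra.
  by have := ler_norm (v - u); rewrite distrC => ?; apply/orP; right; lra.
by rewrite ler_norml lerNl opprB {1}distrC !h.
Qed.

Lemma tent_lipschitz p q c K n x y : 0 <= K ->
  `|tent p q c K n x - tent p q c K n y| <= (K * n%:R) * `|x - y|.
Proof.
move=> K0; rewrite /tent.
set a := Num.max 0 _; set b := Num.max 0 _.
rewrite (_ : c - K * a - (c - K * b) = - (K * (a - b))); last by ring.
rewrite normrN normrM (ger0_norm K0) -mulrA ler_wpM2l//.
apply: (le_trans (dist_max0 _ _)).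
set a' := Num.min _ _; set b' := Num.min _ _.
rewrite (_ : _ - _ = - (n%:R * (a' - b'))); last by ring.
rewrite normrN normrM (ger0_norm (ler0n _ _)) ler_wpM2l//.
exact: dist_min.
Qed.

Lemma tent_real_Linf p q c K n : 0 <= K -> real_Linf mu (tent p q c K n).
Proof.
move=> K0; have tL := tent_lipschitz p q c n _ _ K0; split.
  apply: continuous_measurable_fun => x; apply/cvgrPdist_lt => e e0.
  have L0 : 0 < K * n%:R + 1 by rewrite ltr_wpDl// mulr_ge0.
  near=> y; rewrite (le_lt_trans (tL _ _))//.
  rewrite (@le_lt_trans _ _ ((K * n%:R + 1) * `|x - y|))//.
    by rewrite ler_wpM2r// lerDl.
  rewrite mulrC -ltr_pdivlMr//; near: y; apply: cvgr_dist_lt => //.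
  by rewrite divr_gt0.
exists (`|tent p q c K n 0| + K * n%:R); apply: filterS (ae01 R) => x /andP[x0 x1].
rewrite -[X in `|X|](subrK (tent p q c K n 0)) addrC.
rewrite (le_trans (ler_normD _ _))// lerD2l (le_trans (tL _ _))//.
by rewrite subr0 ger0_norm// ler_piMr// mulr_ge0.
Unshelve. all: by end_near. Qed.

(** With K = |c| + |M| all the tents are below Re h, hence below
    Re (phi h), and at each point of ]p, q[ they are equal to c for large n. *)
Lemma phi_local_lb h p q c : 0 <= p -> q <= 1 ->
  (\forall x \ae mu, p < x < q -> c <= complex.Re (repr h x)) ->
  \forall x \ae mu, p < x < q -> c <= complex.Re (repr (phi h) x).
Proof.
move=> p0 q1 ch; have [[_ [M hM]] _] := repr_real_Linf h.
pose K := `|c| + `|M|.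
have K0 : 0 <= K by rewrite addr_ge0.
have H n : \forall x \ae mu, tent p q c K n x <= complex.Re (repr (phi h) x).
  have Kn : 0 <= K * n%:R by rewrite mulr_ge0.
  have [v Cv vt] := C01_lipschitz (tent_real_Linf p q c n K0) Kn
    (fun x y => tent_lipschitz p q c n x y K0).
  have : \forall x \ae mu, complex.Re (repr v x) <= complex.Re (repr (phi h) x).
    apply: phi_Re_ge => //; apply: filterS3 ch hM vt => x cx hx <- /=.
    rewrite /tent; have [/andP[px xq]|npq] := boolP (p < x < q).
      apply: le_trans (cx _); last by rewrite px.
      by rewrite gerBl mulr_ge0// le_max lexx.
    have m0 : Num.min (x - p) (q - x) <= 0.
      by move: npq; rewrite ge_min !subr_le0 negb_and -!leNgt.
    have m1 : 1 <= Num.max 0 (1 - n%:R * Num.min (x - p) (q - x)).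
      by rewrite le_max lerDl oppr_ge0 mulr_ge0_le0 ?orbT.
    have : K * 1 <= K * Num.max 0 (1 - n%:R * Num.min (x - p) (q - x)).
      by rewrite ler_wpM2l.
    move: hx; rewrite ler_norml => /andP[hx _]; have := ler_norm c; have := ler_norm M.
    by rewrite /K; move: (Num.max 0 _) => m; lra.
  by apply: filterS2 vt => x <-.
have /ae_foralln := H; apply: filterS => x Hx /andP[px xq].
pose m := Num.min (x - p) (q - x).
have m0 : 0 < m by rewrite lt_min !subr_gt0 px.
pose n := (Num.truncn (1 / m)).+1.
have : 1 / m < n%:R by exact: truncnS_gt.
rewrite ltr_pdivrMr// => nm; have := Hx n; rewrite /tent -/m.
rewrite (_ : Num.max 0 _ = 0) ?mulr0 ?subr0//.
by apply/max_idPl; rewrite subr_le0 ltW.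
Qed.

End local_bounds.

(** * Riemann integrable functions are fixed *)

Section riemann_implies_fixed.
Variable R : realType.
Local Notation mu := (lebesgue01 R).
Local Notation W := (Linf mu).

(** The set where k is nearly maximal has positive measure, so f = k somewhere
    in it: essential suprema of k are nearly attained by values of f. *)
Lemma near_sup_tag (k f : R -> R) (p q e : R) : real_Linf mu k -> 0 < e ->
  (\forall x \ae mu, f x = k x) -> 0 <= p -> p < q -> q <= 1 ->
  exists2 t, p <= t <= q & \forall y \ae mu, p < y < q -> k y <= f t + e.
Proof.
move=> bk e0 fk p0 pq q1.
have mE : measurable (`]p, q[%classic : set (measurableTypeR R)) by exact: measurable_itv.
have E0 : (0 < mu `]p, q[%classic)%E.
  by rewrite lebesgue01_itv ?(ltW pq)// lte_fin subr_gt0.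
have [A [s [mA AE A0 sA kE]]] := near_ess_sup mE E0 bk e0.
have [N [mN N0 fN]] := fk.
have [t [At Nt]] : A `\` N !=set0.
  apply/set0P/negP => /eqP; rewrite setD_eq0 => AN.
  have : (mu A <= mu N)%E by apply: le_measure; rewrite ?inE.
  by rewrite N0 leNgt A0.
have ft : f t = k t by apply: contrapT => nt; apply: Nt; exact: fN.
have := AE t At; rewrite /= in_itv/= => /andP[pt tq].
exists t; first by rewrite !ltW.
apply: filterS kE => y + yE; rewrite /= in_itv/= => /(_ yE) /le_trans; apply.
by rewrite lerD2r ft sA.
Qed.

Section uniform_partition.
Variable n : nat.
Definition unif_point (i : nat) : R := i%:R / n.+1%:R.
Definition unif_partition : seq R := mkseq (fun i => unif_point i.+1) n.+1.

Lemma unif_point_lt i j : (i < j)%N -> unif_point i < unif_point j.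
Proof. by move=> ij; rewrite ltr_pM2r ?ltr_nat// invr_gt0. Qed.

Lemma unif_point01 i : (i <= n.+1)%N -> 0 <= unif_point i <= 1.
Proof.
move=> iN; rewrite divr_ge0//= ler_pdivrMr// mul1r ler_nat.
by rewrite iN.
Qed.

Lemma nth_unif_partition i : (i < n.+1)%N -> unif_partition`_i = unif_point i.+1.
Proof. by move=> iN; rewrite nth_mkseq. Qed.

Lemma nth_cons_unif_partition i : (i < n.+1)%N ->
  (0 :: unif_partition)`_i = unif_point i.
Proof.
case: i => [_|i iN] /=; first by rewrite /unif_point mul0r.
by rewrite nth_mkseq// ltnW.
Qed.

Lemma size_unif_partition : size unif_partition = n.+1.
Proof. exact: size_mkseq. Qed.

Lemma unif_itv_partition : itv_partition 0 1 unif_partition.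
Proof.
split.
  apply/(pathP 0) => i; rewrite size_unif_partition => iN.
  by rewrite nth_unif_partition// nth_cons_unif_partition// unif_point_lt.
rewrite -nth_last size_unif_partition (set_nth_default 0) ?size_unif_partition//.
by rewrite nth_unif_partition// /unif_point divff.
Qed.

Lemma unif_mesh i : (i < n.+1)%N ->
  unif_partition`_i - (0 :: unif_partition)`_i = n.+1%:R^-1.
Proof.
move=> iN; rewrite nth_unif_partition// nth_cons_unif_partition// /unif_point.
by rewrite -mulrBl -natrB// subSnn mul1r.
Qed.

Lemma unif_tagged (t : nat -> R) :
  (forall i, (i < n.+1)%N -> unif_point i <= t i <= unif_point i.+1) ->
  tagged_partition 0 1 unif_partition (mkseq t n.+1).
Proof.
move=> tP; split; first exact: unif_itv_partition.
  by rewrite size_mkseq size_unif_partition.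
move=> i; rewrite size_unif_partition => iN.
by rewrite nth_unif_partition// nth_cons_unif_partition// nth_mkseq// tP.
Qed.

Lemma unif_step_at (f : R -> R) (t : nat -> R) (x : R) : 0 <= x < 1 ->
  exists i, [/\ (i < n.+1)%N, unif_point i <= x < unif_point i.+1 &
    step f 0 unif_partition (mkseq t n.+1) x = f (t i)].
Proof.
move=> x01; have [pth /eqP l1] := unif_itv_partition.
have [||i [iN hi ix]] := @step_at _ f 0 unif_partition (mkseq t n.+1) x _ pth.
- by rewrite size_mkseq size_unif_partition.
- by rewrite l1.
rewrite size_unif_partition in iN; exists i; split => //.
  by rewrite -nth_cons_unif_partition// -nth_unif_partition.
by rewrite hi nth_mkseq.
Qed.

End uniform_partition.

Variable phi : {linear W -> W}.
Hypothesis phi_cc : completely_contractive (@Linf_mxnorm _ _ R mu) phi.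
Hypothesis phi_C : forall v, C01 v -> phi v = v.

(** For a fine uniform partition, tags t and t' at which Re f nearly attains the
    essential supremum and infimum of Re g on each interval confine both Re g
    and Re (phi g), so the integral of their distance is at most the difference
    of the two Riemann sums plus 2 eps. *)
Lemma riemann_fixed_Re (f : R -> R[i]) (g : W) :
  riemann_integrable 0 1 f -> is_class_of mu g f ->
  \forall x \ae mu, complex.Re (repr (phi g) x) = complex.Re (repr g x).
Proof.
move=> [I fI] fg; have [bk _] := repr_real_Linf g; have [bphi _] := repr_real_Linf (phi g).
pose k x := complex.Re (repr g x); pose u x := complex.Re (repr (phi g) x).
pose fr x := complex.Re (f x).
have mD : measurable (`[0, 1[%classic : set (measurableTypeR R)) by exact: measurable_itv.
have frk : \forall x \ae mu, fr x = k x.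
  by apply: filterS fg => x fx; rewrite /fr fx.
have Nfrk : \forall x \ae mu, - fr x = - k x by apply: filterS frk => x ->.
have bNk : real_Linf mu (fun x => - k x).
  have := real_Linf_lin (-1) bk (real_Linf_cst mu 0).
  by rewrite (_ : (fun x => _) = (fun x => - k x))//; apply/funext => x; rewrite addr0 mulN1r.
have bd : real_Linf mu (fun x => -1 * k x + u x) by exact: real_Linf_lin.
have babs : real_Linf mu (fun x => `|-1 * k x + u x|).
  have [md [M dM]] := bd; split; first exact: measurableT_comp.
  by exists M; apply: filterS dM => x; rewrite normr_id.
have lo (p q c : R) : 0 <= p -> q <= 1 -> (\forall x \ae mu, p < x < q -> c <= k x) ->
    \forall x \ae mu, p < x < q -> c <= u x.
  by move=> p0 q1; exact: phi_local_lb.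
have up (p q c : R) : 0 <= p -> q <= 1 -> (\forall x \ae mu, p < x < q -> k x <= c) ->
    \forall x \ae mu, p < x < q -> u x <= c.
  move=> p0 q1 kc.
  have : \forall x \ae mu, p < x < q -> - c <= complex.Re (repr (phi (-1 *: g)) x).
    apply: phi_local_lb => //; apply: filterS2 kc (reprZ (-1) g) => x kcx ->.
    by move=> /kcx; rewrite cReM/= -/(k x); lra.
  rewrite linearZ/=; apply: filterS2 (reprZ (-1) (phi g)) => x -> ux /ux.
  by rewrite cReM/= -/(u x); lra.
(* 2 e come from the two Riemann sums and 2 e from the choice of the tags. *)
have small (e : R) : 0 < e -> \int[mu]_(x in `[0, 1[) `|-1 * k x + u x| <= 4 * e.
  move=> e0; have [d d0 hd] := fI e e0.
  have [n _ /(_ n (leqnn n)) nd] := near_infty_natSinv_lt (PosNum d0).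
  pose P := unif_point n.
  have P0 i : (i < n.+1)%N -> 0 <= P i by move=> iN; have /andP[] := unif_point01 (ltnW iN).
  have P1 i : (i < n.+1)%N -> P i.+1 <= 1 by move=> iN; have /andP[] := unif_point01 iN.
  have tags (k' f' : R -> R) : real_Linf mu k' -> (\forall x \ae mu, f' x = k' x) ->
      exists t : nat -> R, forall i, (i < n.+1)%N -> P i <= t i <= P i.+1 /\
        \forall y \ae mu, P i < y < P i.+1 -> k' y <= f' (t i) + e.
    move=> bk' fk'; have H i : exists t, (i < n.+1)%N -> P i <= t <= P i.+1 /\
        \forall y \ae mu, P i < y < P i.+1 -> k' y <= f' t + e.
      have [iN|iN] := boolP (i < n.+1)%N; last by exists 0.
      have [t ? ?] := near_sup_tag bk' e0 fk' (P0 _ iN)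
        (unif_point_lt n (ltnSn i)) (P1 _ iN).
      by exists t.
    by have [t tP] := choice H; exists t.
  have [t tP] := tags _ _ bk frk; have [t' t'P] := tags _ _ bNk Nfrk.
  pose s := unif_partition n.
  have tg : tagged_partition 0 1 s (mkseq t n.+1) by apply: unif_tagged => i /tP[].
  have tg' : tagged_partition 0 1 s (mkseq t' n.+1) by apply: unif_tagged => i /t'P[].
  have ms : mesh_lt 0 s d.
    by move=> i; rewrite size_unif_partition => iN; rewrite unif_mesh.
  have st : size (mkseq t n.+1) = size s by rewrite size_mkseq size_unif_partition.
  have st' : size (mkseq t' n.+1) = size s by rewrite size_mkseq size_unif_partition.
  have sums : real_riemann_sum fr 0 s (mkseq t n.+1) -
              real_riemann_sum fr 0 s (mkseq t' n.+1) <= 2 * e.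
    have [<- _] := riemann_sumE f st; have [<- _] := riemann_sumE f st'.
    have := Re_le_cmod (riemann_sum 0 f s (mkseq t n.+1) - I).
    have := Re_le_cmod (riemann_sum 0 f s (mkseq t' n.+1) - I).
    have := hd _ _ tg ms; have := hd _ _ tg' ms; rewrite !raddfB/=.
    move=> h1 h2; rewrite !ler_norml => /andP[h3 _] /andP[_ h4]; lra.
  pose S := step fr 0 s (mkseq t n.+1); pose S' := step fr 0 s (mkseq t' n.+1).
  have bound : \forall x \ae mu, 0 <= x < 1 -> `|-1 * k x + u x| <= S x - S' x + 2 * e.
    have all_up : \forall x \ae mu, forall i, (i < n.+1)%N -> P i < x < P i.+1 ->
        k x <= fr (t i) + e /\ u x <= fr (t i) + e.
      apply/ae_foralln => i; have [iN|_] := boolP (i < n.+1)%N; last exact: aeW.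
      have [_ kt] := tP i iN.
      apply: filterS2 (kt) (up _ _ _ (P0 _ iN) (P1 _ iN) kt) => x k1 k2 _ Px.
      by split; [exact: k1|exact: k2].
    have all_lo : \forall x \ae mu, forall i, (i < n.+1)%N -> P i < x < P i.+1 ->
        fr (t' i) - e <= k x /\ fr (t' i) - e <= u x.
      apply/ae_foralln => i; have [iN|_] := boolP (i < n.+1)%N; last exact: aeW.
      have [_ kt] := t'P i iN.
      have {}kt : \forall x \ae mu, P i < x < P i.+1 -> fr (t' i) - e <= k x.
        by apply: filterS kt => x h /h; lra.
      apply: filterS2 (kt) (lo _ _ _ (P0 _ iN) (P1 _ iN) kt) => x k1 k2 _ Px.
      by split; [exact: k1|exact: k2].
    have notP : \forall x \ae mu, ~ range P x.
      by apply: countable_ae01; apply: sub_countable (card_image_le _ _) _; exact: countableP.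
    apply: filterS3 all_up all_lo notP => x xup xlo xP x01.
    have [i [iN ix Si]] := unif_step_at n fr t x01.
    have [j [jN jx Sj]] := unif_step_at n fr t' x01.
    (* t and t' are tags of the same partition, so x lies in one interval. *)
    have ij : i = j.
      have lt_of a b : P a <= x -> x < P b.+1 -> (a <= b)%N.
        move=> ax xb; rewrite leqNgt; apply/negP => ba.
        have : P b.+1 <= P a.
          move: ba; rewrite leq_eqVlt => /predU1P[->//|ba].
          exact/ltW/unif_point_lt.
        by rewrite leNgt (le_lt_trans ax xb).
      move: ix jx => /andP[i1 i2] /andP[j1 j2].
      by apply/eqP; rewrite eqn_leq !lt_of.
    subst j; rewrite /S /S' Si Sj.
    have Pix : P i < x < P i.+1.
      move: ix => /andP[i1 i2]; rewrite i2 andbT lt_neqAle i1 andbT.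
      by apply/eqP => Pi; apply: xP; exists i.
    have [k1 u1] := xup i iN Pix; have [k2 u2] := xlo i iN Pix.
    by rewrite ler_norml; apply/andP; split; lra.
  have iS f' t0 : mu.-integrable `[0, 1[%classic (EFin \o step f' 0 s t0).
    exact: step_integrable.
  have i2e : mu.-integrable `[0, 1[%classic (EFin \o (fun=> 2 * e)).
    exact: (real_Linf_integrable (lebesgue01_lty R) (real_Linf_cst mu (2 * e)) mD).
  have iSS : mu.-integrable `[0, 1[%classic (EFin \o (fun x => S x - S' x)).
    by have := integrableB mD (iS fr (mkseq t n.+1)) (iS fr (mkseq t' n.+1)).
  have iB : mu.-integrable `[0, 1[%classic (EFin \o (fun x => S x - S' x + 2 * e)).
    by have := integrableD mD iSS i2e.
  have intS t0 : size t0 = size s ->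
      \int[mu]_(x in `[0, 1[) step fr 0 s t0 x = real_riemann_sum fr 0 s t0.
    move=> st0; have [pth /eqP l1] := unif_itv_partition n.
    have := @Rintegral_step _ fr 0 s t0 st0 pth (lexx 0).
    by rewrite l1; apply.
  apply: (@le_trans _ _ (\int[mu]_(x in `[0, 1[) (S x - S' x + 2 * e))).
    apply: ae_le_Rintegral => //.
      by apply: real_Linf_integrable => //; exact: lebesgue01_lty.
  rewrite RintegralD// RintegralB ?(iS _ _)// /S /S' intS// intS//.
  rewrite Rintegral_cst// lebesgue01_itv//= subr0 mulr1.
  by move: sums; lra.
have int0 : \int[mu]_(x in `[0, 1[) `|-1 * k x + u x| = 0.
  apply/eqP; rewrite eq_le Rintegral_ge0 ?andbT//.
  apply/ler_addgt0Pr => e e0; rewrite add0r.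
  have e40 : 0 < e / 4 by rewrite divr_gt0.
  by have := small _ e40; lra.
have iabs : mu.-integrable `[0, 1[%classic (EFin \o (fun x => `|-1 * k x + u x|)).
  by apply: real_Linf_integrable => //; exact: lebesgue01_lty.
have := EFin_Rintegral mD iabs; rewrite int0 => /esym int0'.
have md : measurable_fun (`[0, 1[%classic : set (measurableTypeR R))
    (EFin \o (fun x => -1 * k x + u x)).
  by apply/measurable_EFinP/measurable_funTS; case: bd.
have /(_ int0') := (ae_eq_integral_abs mu mD md).1.
have ne1 : \forall x \ae mu, ~ [set (1 : R)] x by apply: countable_ae01.
apply: filterS3 ne1 (ae01 R) => x x1 /andP[x0 x1'] /=.
rewrite in_itv/= x0 lt_neqAle x1' andbT.
have /eqP -> : x <> 1 by move=> h; apply: x1.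
by move=> /(_ isT)[]; rewrite /k /u; lra.
Qed.

End riemann_implies_fixed.

(** * The fixed set *)

Section main.
Variable R : realType.
Implicit Types f : R -> R[i].

Lemma riemann_sumZ (a : R[i]) f (x : R) (s t : seq R) :
  riemann_sum x (fun y => a * f y) s t = a * riemann_sum x f s t.
Proof. by rewrite /riemann_sum mulr_sumr; apply: eq_bigr => i _; rewrite mulrA. Qed.

Lemma riemann_integrableZ (a : R[i]) f (x y : R) :
  riemann_integrable x y f -> riemann_integrable x y (fun z => a * f z).
Proof.
move=> [I fI]; exists (a * I) => e e0.
have a1 : 0 < cmod a + 1 by rewrite ltr_wpDl ?cmod_ge0.
have [d d0 hd] := fI _ (divr_gt0 e0 a1); exists d => // s t tst mst.
rewrite riemann_sumZ -mulrBr cmodM.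
rewrite (@le_lt_trans _ _ ((cmod a + 1) * cmod (riemann_sum x f s t - I)))//.
  by rewrite ler_wpM2r ?cmod_ge0// lerDl.
by rewrite mulrC -ltr_pdivlMr// hd.
Qed.

Lemma riemann_fixed (g : Linf (lebesgue01 R)) f :
  riemann_integrable 0 1 f -> is_class_of (lebesgue01 R) g f ->
  fixed_set (@Linf_mxnorm _ _ R (lebesgue01 R)) (@C01 R) g.
Proof.
move=> rf gf phi phi_cc phi_C.
have re := riemann_fixed_Re phi_cc phi_C rf gf.
have gf' : is_class_of (lebesgue01 R) (- 'i *: g) (fun x => - 'i * f x).
  by apply: filterS2 gf (reprZ (- 'i) g) => x -> ->.
have im := riemann_fixed_Re phi_cc phi_C (riemann_integrableZ (- 'i) rf) gf'.
rewrite linearZ/= in im.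
apply: (@is_class_of_inj _ _ _ _ _ _ (repr (phi g))); first exact: aeW.
apply: filterS3 re im (filterI (reprZ (- 'i) g) (reprZ (- 'i) (phi g))).
move=> x re im [Ex Ex']; apply: complex_eqP => //.
by move: im; rewrite Ex Ex' !cReM/=; lra.
Qed.

End main.

Theorem theorem4p27 (R : realType) :
  fixed_set (@Linf_mxnorm _ _ R (lebesgue01 R)) (@C01 R) =
  [set g : Linf (lebesgue01 R) | exists2 f : R -> R[i],
     riemann_integrable 0 1 f & is_class_of (lebesgue01 R) g f].
Proof.
apply/seteqP; split=> [g|g [f]]; [exact: fixed_riemann|exact: riemann_fixed].
Qed.
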